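(* Let $(G,\sigma)$ be a 2-edge-connected cubic signed graph with even negativeness $\epsilon(G,\sigma)$. Then $\mathrm{scc}(G,\sigma)<\frac{23}{9}|E(G)|$.
   Context: A signed graph $(G,\sigma)$ is a graph $G$ with a map $\sigma:E(G)\to\{-1,+1\}$; an edge $e$ is negative if $\sigma(e)=-1$, positive otherwise. A cycle is a connected 2-regular subgraph; it is positive if it contains an even number of negative edges, negative otherwise. A barbell is a pair of edge-disjoint negative cycles joined by a path (possibly of length zero). A circuit is a positive cycle or a barbell. A circuit cover is a family of circuits whose union contains every edge; its length is the sum of the numbers of edges of its members. $\mathrm{scc}(G,\sigma)$ is the minimum length of a circuit cover. For an edge cut $S$ (a minimal set of edges whose removal disconnects $G$), switching at $S$ multiplies the signs of the edges in $S$ by $-1$; two signatures are equivalent if one is obtained from the other in this way. The negativeness $\epsilon(G,\sigma)$ is the minimum number of negative edges over all signatures equivalent to $\sigma$. *)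

(* Defs.v *)
From mathcomp Require Import all_boot.

Set Implicit Arguments.
Unset Strict Implicit.
Unset Printing Implicit Defensive.

(* Finite multigraphs: parallel edges and loops are allowed. The order of the
   two components of [ends e] is irrelevant everywhere below. *)
Record mgraph := MGraph {
  vertex : finType;
  edge : finType;
  ends : edge -> vertex * vertex }.

Section Graph.
Variable G : mgraph.
Implicit Types (F S C : {set edge G}) (e : edge G) (u v w : vertex G).

Definition joins e u v : bool := (ends e == (u, v)) || (ends e == (v, u)).

(* A loop contributes 2 to the degree. *)
Definition degree F v : nat :=
  \sum_(e in F) (((ends e).1 == v) + ((ends e).2 == v)).

Definition vertices_of F : {set vertex G} :=
  [set v | [exists e in F, ((ends e).1 == v) || ((ends e).2 == v)]].

Definition adj F : rel (vertex G) := [rel u v | [exists e in F, joins e u v]].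

(* Connectedness of the spanning subgraph with edge set F; the graph without
   vertices is not connected. *)
Definition spanning_connected F : bool :=
  (0 < #|vertex G|) && [forall u, forall v, connect (adj F) u v].

Definition cubic : Prop := forall v, degree setT v = 3.

Definition two_edge_connected : Prop :=
  forall S, #|S| < 2 -> spanning_connected (~: S).

Definition edge_cut S : bool :=
  minset (fun S' : {set edge G} => ~~ spanning_connected (~: S')) S.

(* A 2-regular subgraph has no isolated vertex, so it is determined by its edge
   set; cycles and circuits are represented by their edge sets. *)
Definition is_cycle C : Prop :=
  [/\ C != set0,
      {in vertices_of C, forall v, degree C v = 2} &
      {in vertices_of C &, forall u v, connect (adj C) u v}].

(* A walk from u is the list of its steps (edge traversed, vertex reached). *)
Fixpoint is_walk u (p : seq (edge G * vertex G)) : bool :=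
  if p is (e, w) :: p' then joins e u w && is_walk w p' else true.

Definition walk_vertices u (p : seq (edge G * vertex G)) : seq (vertex G) :=
  u :: [seq x.2 | x <- p].

Definition walk_edges (p : seq (edge G * vertex G)) : {set edge G} :=
  [set e in [seq x.1 | x <- p]].

Definition is_path u v (p : seq (edge G * vertex G)) : Prop :=
  [/\ is_walk u p, uniq (walk_vertices u p) & last u [seq x.2 | x <- p] = v].

(* [true] stands for the sign -1, so multiplication by -1 is negation. *)
Definition signature := {ffun edge G -> bool}.

Implicit Types sigma tau : signature.

Definition negative_edges sigma : {set edge G} := [set e | sigma e].

Definition switch S sigma : signature := [ffun e => (e \in S) (+) sigma e].

(* The equivalence generated by switching at (minimal) edge cuts. *)
Definition switch_equiv : rel signature :=
  connect [rel sigma tau | [exists S, edge_cut S && (tau == switch S sigma)]].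

Definition negativeness sigma : nat :=
  #|negative_edges
      [arg min_(tau < sigma | switch_equiv sigma tau) #|negative_edges tau|]|.

Definition negative_cycle sigma C : Prop :=
  is_cycle C /\ odd #|C :&: negative_edges sigma|.

Definition positive_cycle sigma C : Prop :=
  is_cycle C /\ ~~ odd #|C :&: negative_edges sigma|.

(* The path meets each cycle only in the corresponding end, and the cycles meet
   each other at most in a common end of a path of length zero. *)
Definition barbell sigma (B : {set edge G}) : Prop :=
  exists C1 C2 v1 v2 p,
    [/\ negative_cycle sigma C1 /\ negative_cycle sigma C2,
        [disjoint C1 & C2],
        is_path v1 v2 p,
        (vertices_of C1 :&: ([set v in walk_vertices v1 p] :|: vertices_of C2)
           = [set v1]) /\
        (vertices_of C2 :&: ([set v in walk_vertices v1 p] :|: vertices_of C1)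
           = [set v2]) &
        B = C1 :|: C2 :|: walk_edges p].

Definition circuit sigma C : Prop := positive_cycle sigma C \/ barbell sigma C.

Definition circuit_cover sigma (F : seq {set edge G}) : Prop :=
  (forall C, C \in F -> circuit sigma C) /\
  (forall e, exists2 C, C \in F & e \in C).

Definition cover_length (F : seq {set edge G}) : nat := \sum_(C <- F) #|C|.

(* scc is a partial function of (G, sigma), since a signed graph need not have a
   circuit cover; [is_scc sigma n] says that it is defined and equal to n. *)
Definition is_scc sigma (n : nat) : Prop :=
  (exists2 F : seq {set edge G}, circuit_cover sigma F & cover_length F = n) /\
  (forall F : seq {set edge G}, circuit_cover sigma F -> n <= cover_length F).

End Graph.

(* Main.v *)
(* Let N be the set of negative edges of an equivalent signature with as few of them as
   possible, m the number of edges, and F the set of the positive edges that lie on a cycle of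
   positive edges. All cycles in F are positive, and Jaeger's eight-flow theorem covers F by
   three even sets of total size at most 12/7 |F|. Minimality of N shows that the positive
   edges span a connected graph, so some even set Z contains N; by minimality of N again, Z
   contains all edges outside F, and if Z has least size, then it contains at most half of F.
   The graph is cubic, so the components of Z are disjoint cycles. The negative ones are even
   in number and are paired to barbells by the paths of a T-join, where T meets each of them
   once. A minimum T-join in a bridgeless cubic graph has at most |V|/2 = m/3 edges. The total
   length is at most 12/7 |F| + (m - |F|) + |F|/2 + m/3 <= 107/42 m < 23/9 m. *)

Require Import Defs.
From Stdlib Require Import Classical.
From mathcomp Require Import all_boot all_order all_algebra.
From mathcomp Require Import zify.
Import Order.TTheory GRing.Theory Num.Theory.

Set Implicit Arguments.
Unset Strict Implicit.
Unset Printing Implicit Defensive.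

(** * Parity of degrees, joins and cuts *)

(** Even sets and joins replace cycles and paths: an edge set is handled through the parities of its
    degrees, and exchanges are symmetric differences. Explicit walks with their edges appear only
    where barbells are assembled. The delicate term is m/3 for the T-join. If every cut had at least
    three edges, the value 1/3 on each edge would satisfy all T-cut constraints, but a cut of two
    edges that separates an odd part of T violates them. The bound therefore comes from an integral
    argument: stars with a single edge of the join are contracted one at a time, and an integer
    account with a parity clause pays one unit for each. Subdividing every edge first makes the
    graph bipartite, so that weights of even sets are even. Even negativeness makes the number of
    negative cycles in Z, and hence the size of T, even. *)

Section Parity.
Variable G : mgraph.
Implicit Types (X Y Z : {set edge G}) (S : {set vertex G}) (e : edge G).
Implicit Types u v w : vertex G.

Definition par X v : bool :=
  \big[addb/false]_(e in X) (((ends e).1 == v) (+) ((ends e).2 == v)).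

Definition even_set X : bool := [forall v, ~~ par X v].

Definition join X u v : Prop := forall w, par X w = (w == u) (+) (w == v).

Definition cut S : {set edge G} :=
  [set e | ((ends e).1 \in S) (+) ((ends e).2 \in S)].

Definition symd X Y : {set edge G} := [set e | (e \in X) (+) (e \in Y)].

Definition incident e v : bool := ((ends e).1 == v) || ((ends e).2 == v).

Lemma even_setP X : reflect (forall v, par X v = false) (even_set X).
Proof.
by apply: (iffP forallP) => h v; [apply/negbTE/h | rewrite h].
Qed.

Lemma odd_degree X v : odd (degree X v) = par X v.
Proof.
rewrite /degree /par (big_morph odd oddD (erefl _)).
by apply: eq_bigr => e _; rewrite oddD !oddb.
Qed.

Lemma par_symd X Y v : par (symd X Y) v = par X v (+) par Y v.
Proof.
rewrite /par big_mkcond [in RHS]big_mkcond [X in _ (+) X]big_mkcond -big_split.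
apply: eq_bigr => e _; rewrite inE.
by case: (e \in X); case: (e \in Y) => //=; rewrite ?addbF ?addbb.
Qed.

Lemma par0 v : par set0 v = false.
Proof. by rewrite /par big_set0. Qed.

Lemma par1 e v : par [set e] v = ((ends e).1 == v) (+) ((ends e).2 == v).
Proof. by rewrite /par big_set1. Qed.

Lemma even_set0 : even_set set0.
Proof. by apply/even_setP => v; rewrite par0. Qed.

Lemma symd_subset X Y Z : X \subset Z -> Y \subset Z -> symd X Y \subset Z.
Proof.
move=> /subsetP sX /subsetP sY; apply/subsetP => e; rewrite inE.
by have := sX e; have := sY e; case: (e \in X); case: (e \in Y) => //= h1 h2 _; auto.
Qed.

Lemma symdC X Y : symd X Y = symd Y X.
Proof. by apply/setP => e; rewrite !inE addbC. Qed.

Lemma symd_disjoint X Y : [disjoint X & Y] -> symd X Y = X :|: Y.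
Proof.
move=> /pred0P d; apply/setP => e; rewrite !inE.
by have := d e => /=; case: (e \in X); case: (e \in Y).
Qed.

Lemma symd_sub X Y : Y \subset X -> symd X Y = X :\: Y.
Proof.
move=> /subsetP s; apply/setP => e; rewrite !inE.
by have := s e; case: (e \in X); case: (e \in Y) => // h; have := h isT.
Qed.

Lemma par_setU X Y v : [disjoint X & Y] -> par (X :|: Y) v = par X v (+) par Y v.
Proof. by move=> d; rewrite -symd_disjoint // par_symd. Qed.

Lemma par_setD X Y v : Y \subset X -> par (X :\: Y) v = par X v (+) par Y v.
Proof. by move=> s; rewrite -symd_sub // par_symd. Qed.

Lemma even_symd X Y : even_set X -> even_set Y -> even_set (symd X Y).
Proof.
by move=> /even_setP eX /even_setP eY; apply/even_setP => v; rewrite par_symd eX eY.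
Qed.

Lemma join_even X u : join X u u -> even_set X.
Proof. by move=> h; apply/even_setP => v; rewrite h addbb. Qed.

Lemma even_join X u : even_set X -> join X u u.
Proof. by move=> /even_setP h v; rewrite h addbb. Qed.

Lemma join_sym X u v : join X u v -> join X v u.
Proof. by move=> h w; rewrite h addbC. Qed.

Lemma join_trans X Y u v w : join X u v -> join Y v w -> join (symd X Y) u w.
Proof.
by move=> h1 h2 z; rewrite par_symd h1 h2; case: (z == u); case: (z == v); case: (z == w).
Qed.

Lemma join_symd_even X Y u v : join X u v -> even_set Y -> join (symd X Y) u v.
Proof. by move=> h1 /even_setP h2 z; rewrite par_symd h1 h2 addbF. Qed.

Lemma even_joins X Y u v : join X u v -> join Y u v -> even_set (symd X Y).
Proof. by move=> h1 h2; apply/even_setP => z; rewrite par_symd h1 h2 addbb. Qed.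

Lemma join1 e : join [set e] (ends e).1 (ends e).2.
Proof. by move=> w; rewrite par1 ![_ == w]eq_sym. Qed.

Lemma joins_join e u v : joins e u v -> join [set e] u v.
Proof.
move=> h w; have := join1 e w; case/orP: h => /eqP -> /= -> //.
by rewrite addbC.
Qed.

Lemma join_nonempty X u v : join X u v -> u != v -> X != set0.
Proof.
move=> h uv; apply/eqP => X0; move: (h u).
by rewrite X0 par0 eqxx (negbTE uv).
Qed.

(** Handshake count over S: an edge of X with both ends in S is counted twice and cancels. *)
Lemma par_cut X S :
  \big[addb/false]_(v in S) par X v = odd #|X :&: cut S|.
Proof.
rewrite /par exchange_big /=.
rewrite -sum1_card (big_morph odd oddD (erefl _)) /=.
rewrite big_mkcond [RHS]big_mkcond; apply: eq_bigr => e _.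
rewrite !inE; case: (e \in X) => //=.
rewrite big_split /=.
have one (a : vertex G) : \big[addb/false]_(v in S) (a == v) = (a \in S).
  case aS: (a \in S); last first.
    rewrite big1 // => v vS; apply/negbTE; apply: contraFneq aS => -> //.
  rewrite (bigD1 a) //= eqxx big1 // => v /andP [_ va].
  by rewrite eq_sym (negbTE va).
by rewrite !one; case: (_ (+) _).
Qed.

Lemma odd_set_par X S : odd #|[set v in S | par X v]| = odd #|X :&: cut S|.
Proof.
rewrite -par_cut -sum1dep_card (big_morph odd oddD (erefl _)) /= big_mkcondr /=.
by apply: eq_bigr => v _; case: (par X v).
Qed.

Lemma even_cut X S : even_set X -> odd #|X :&: cut S| = false.
Proof. by move=> /even_setP h; rewrite -par_cut big1. Qed.

Lemma par_incident X v : par X v -> exists2 e, e \in X & incident e v.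
Proof.
move=> h; case: (pickP [pred e | (e \in X) && incident e v]) => [e /andP [h1 h2]|h0].
  by exists e.
move: h; rewrite /par big1 // => e eX.
have := h0 e; rewrite /= eX /= /incident => /norP [/negbTE -> /negbTE ->] //.
Qed.

Lemma adj_sym X : symmetric (adj X).
Proof.
move=> u v; rewrite /adj /=; apply: eq_existsb => e.
by rewrite /joins orbC.
Qed.

Lemma conn_sym X : connect_sym (adj X).
Proof. exact/sym_connect_sym/adj_sym. Qed.

Lemma adj_sub X Y : X \subset Y -> subrel (connect (adj X)) (connect (adj Y)).
Proof.
move=> /subsetP s; apply: connect_sub => u v /existsP [e /andP [eX j]].
by apply: connect1; apply/existsP; exists e; rewrite s.
Qed.

Lemma adj_ends X e : e \in X -> adj X (ends e).1 (ends e).2.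
Proof.
move=> eX; apply/existsP; exists e; rewrite eX /joins.
by case: (ends e) => a b /=; rewrite eqxx.
Qed.

Lemma connect_join Y u v : connect (adj Y) u v -> exists2 X : {set edge G}, X \subset Y & join X u v.
Proof.
case/connectP => p; elim: p u => [|w p IH] u /=.
  by move=> _ ->; exists set0; [rewrite sub0set | apply: even_join even_set0].
case/andP => /existsP [e /andP [eY j]] pth lst.
have [X sX jX] := IH _ pth lst.
exists (symd [set e] X); first by rewrite symd_subset ?sub1set.
exact: join_trans (joins_join j) jX.
Qed.

Definition component X u : {set vertex G} := [set v | connect (adj X) u v].

Lemma component_ends X u e : e \in X -> ((ends e).1 \in component X u) = ((ends e).2 \in component X u).
Proof.
move=> eX; rewrite !inE; have := adj_ends eX => /connect1 h.
exact: (same_connect_r (conn_sym X) h).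
Qed.

Lemma cut_component X u : X :&: cut (component X u) = set0.
Proof.
apply/setP => e; rewrite in_setI [e \in cut _]inE in_set0.
by case eX: (e \in X) => //=; rewrite component_ends // addbb.
Qed.

(** No edge of X leaves the component of u, so by [par_cut] this component has an even number of odd
    vertices. *)
Lemma odd_pair X u : par X u -> exists v, [/\ v != u, par X v & connect (adj X) u v].
Proof.
move=> pu.
case: (pickP [pred v | [&& v != u, par X v & connect (adj X) u v]]) => [v /and3P [? ? ?]|h0].
  by exists v.
have := par_cut X (component X u); rewrite cut_component cards0 /=.
rewrite (bigD1 u) ?inE ?connect0 //= pu big1 // => v /andP [vc vu].
by have := h0 v; rewrite /= vu /=; move: vc; rewrite inE => ->; rewrite andbT.
Qed.

Lemma odd_pair_join X u : par X u ->
  exists v (Y : {set edge G}), [/\ v != u, par X v, Y \subset X & join Y u v].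
Proof.
case/odd_pair => v [h1 h2 /connect_join [Y sY jY]].
by exists v, Y.
Qed.

Lemma join_connect X u v : join X u v -> connect (adj X) u v.
Proof.
case: (u =P v) => [->|/eqP uv] h; first exact: connect0.
have /odd_pair [w [wu pw c]] : par X u by rewrite h eqxx (negbTE uv).
by move: pw; rewrite h (negbTE wu) => /eqP <-.
Qed.

Definition component_edges X u : {set edge G} := [set e in X | (ends e).1 \in component X u].

Lemma component_edges_sub X u : component_edges X u \subset X.
Proof. by apply/subsetP => e; rewrite inE => /andP []. Qed.

Lemma component_edges_incident X u e v : v \in component X u -> incident e v ->
  (e \in component_edges X u) = (e \in X).
Proof.
move=> vc inc; rewrite inE; case eX: (e \in X) => //=.
by case/orP: inc => /eqP h; [rewrite h | rewrite (component_ends _ eX) h].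
Qed.

Lemma component_edges_par X u v : par (component_edges X u) v = (v \in component X u) && par X v.
Proof.
rewrite /par; case vc: (v \in component X u) => /=.
  rewrite big_mkcond [RHS]big_mkcond; apply: eq_bigr => e _.
  case inc: (incident e v); first by rewrite (component_edges_incident vc inc).
  by move: inc => /norP [/negbTE -> /negbTE ->]; do 2 case: ifP.
rewrite big1 // => e; rewrite inE => /andP [eX h1].
have h2 := h1; rewrite (component_ends _ eX) in h2.
have [/eqP h|_] := boolP ((ends e).1 == v); first by rewrite -h h1 in vc.
by have [/eqP h|_] := boolP ((ends e).2 == v); first by rewrite -h h2 in vc.
Qed.

Lemma component_edges_connect X u v : v \in component X u -> connect (adj (component_edges X u)) u v.
Proof.
rewrite inE => /connectP [p].
elim/last_ind: p v => [|p w IH] v /=; first by move=> _ ->; exact: connect0.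
rewrite rcons_path last_rcons => /andP [pth a] ->.
apply: connect_trans (IH _ pth erefl) _; apply: connect1.
case/existsP: a => e /andP [eX j]; apply/existsP; exists e; rewrite j andbT.
have lc : last u p \in component X u by rewrite inE; apply/connectP; exists p.
have inc : incident e (last u p).
  by rewrite /incident; case/orP: j => /eqP -> /=; rewrite eqxx ?orbT.
by rewrite (component_edges_incident lc inc).
Qed.

Lemma component_edges_join X u v : join X u v -> join (component_edges X u) u v.
Proof.
move=> h w; rewrite component_edges_par h !inE.
have c := join_connect h.
case: (w =P u) => [->|_]; first by rewrite connect0.
by case: (w =P v) => [->|_]; rewrite ?c ?andbF.
Qed.

Lemma join_parity_set X S r :
  (forall v, v \in S -> connect (adj X) r v) -> ~~ odd #|S| ->
  exists2 Y : {set edge G}, Y \subset X & forall v, par Y v = (v \in S).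
Proof.
move=> conn ev.
(* For odd S the root r takes up the surplus parity; this lets S grow by one vertex at a time. *)
have [Y sY jY] : exists2 Y : {set edge G}, Y \subset X & forall v, par Y v = (v \in S) (+) (odd #|S| && (v == r)).
  move En: #|S| => n; elim: n S En conn {ev} => [S /eqP|n IH S0 En conn].
    by rewrite cards_eq0 => /eqP -> _; exists set0; [exact: sub0set | move=> v; rewrite par0 inE].
  have /card_gt0P [x xS0] : 0 < #|S0| by rewrite En.
  have xS : x \notin S0 :\ x by rewrite !inE eqxx.
  move: En conn xS; rewrite -{1 2}(setD1K xS0); set S := S0 :\ x => En conn xS.
  move: En; rewrite cardsU1 xS add1n => -[En].
  have [//||Y sY jY] := IH S; first by move=> v vS; apply: conn; rewrite in_setU1 vS orbT.
  have /connect_join [P sP jP] := conn x (setU11 _ _).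
  exists (symd Y P); first exact: symd_subset.
  move=> v; rewrite par_symd jY jP -(setD1K xS0) -/S in_setU1 /=.
  case: (v =P x) => [->|_]; first by rewrite (negbTE xS); case: (odd _); case: (x == r).
  by case: (v \in S); case: (odd _); case: (v == r).
by exists Y => // v; rewrite jY (negbTE ev) addbF.
Qed.

(** Stated with even sets instead of cycles, since these pass directly to contractions and
    subdivisions. *)
Definition bridgeless X : Prop := forall e, e \in X -> exists Y : {set edge G}, [/\ even_set Y, Y \subset X & e \in Y].

Lemma bridgeless_cut X S e : bridgeless X -> e \in X -> e \in cut S ->
  exists f, [/\ f \in X, f \in cut S & f != e].
Proof.
move=> br eX eS; have [Y [evY sY eY]] := br e eX.
have := even_cut S evY; rewrite (cardsD1 e) inE eY eS /= => /negbFE od.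
have /card_gt0P [f] : 0 < #|Y :&: cut S :\ e| by case: #|_| od.
rewrite !inE => /and3P [fe fY fS]; exists f; rewrite inE; split => //.
exact: (subsetP sY).
Qed.

Lemma bridgeless_connect X e : bridgeless X -> e \in X ->
  connect (adj (X :\ e)) (ends e).1 (ends e).2.
Proof.
move=> br eX; have [Y [evY sY eY]] := br e eX.
apply: (@adj_sub (Y :\ e)); first exact: setSD.
apply: join_connect => v.
by rewrite par_setD ?sub1set // (even_setP _ evY) -join1.
Qed.

End Parity.

(** * Minimum joins in bridgeless cubic graphs *)

Section Weight.
Variables (G : mgraph) (J : {set edge G}).
Implicit Types X Y : {set edge G}.

Definition weight X : int := (\sum_(e in X) (if e \in J then -1 else 1))%R.

Lemma weightE X : weight X = (#|X :\: J|%:Z - #|X :&: J|%:Z)%R.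
Proof.
rewrite /weight (big_setID J) /= addrC; congr (_ + _)%R.
  rewrite (eq_bigr (fun=> 1%R)) => [|e /setDP [_ /negbTE -> //]].
  by rewrite sumr_const natz.
rewrite (eq_bigr (fun=> (-1)%R)) => [|e /setIP [_ -> //]].
by rewrite sumr_const mulNrn natz.
Qed.

Lemma weightU X Y : [disjoint X & Y] -> weight (X :|: Y) = (weight X + weight Y)%R.
Proof. by move=> d; rewrite /weight -bigU //; apply: eq_bigl => e; rewrite !inE. Qed.

Lemma weightD X Y : Y \subset X -> weight (X :\: Y) = (weight X - weight Y)%R.
Proof. by move=> /setIidPr s; rewrite /weight [in RHS](big_setID Y) /= s addrAC subrr add0r. Qed.

Lemma weight_symd X Y : weight (symd X Y) = (weight X + weight Y - weight (X :&: Y) *+ 2)%R.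
Proof.
have -> : symd X Y = (X :\: Y) :|: (Y :\: X).
  by apply/setP => e; rewrite !inE; case: (e \in X); case: (e \in Y).
rewrite weightU; last first.
  by apply/pred0P => e; rewrite /= !inE; case: (e \in X); case: (e \in Y).
have h (A B : {set edge G}) : weight (A :\: B) = (weight A - weight (A :&: B))%R.
  by rewrite /weight [in RHS](big_setID B) /= addrAC subrr add0r.
by rewrite !h [Y :&: X]setIC; clear; lia.
Qed.

Lemma weight1 e : weight [set e] = (if e \in J then -1 else 1)%R.
Proof. by rewrite /weight big_set1. Qed.

Lemma weight0 : weight set0 = 0%R.
Proof. by rewrite /weight big_set0. Qed.

End Weight.

(** The symmetric difference of J and X has |J| + [weight J X] edges, so for J inside M this says
    that J is a minimum T-join of M for its own set T of odd vertices. *)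
Definition conservative (G : mgraph) (M J : {set edge G}) : Prop :=
  forall X : {set edge G}, X \subset M -> even_set X -> (0 <= weight J X)%R.

Definition star (G : mgraph) (M : {set edge G}) v : {set edge G} :=
  [set e in M | incident e v].

Definition other_end (G : mgraph) (e : edge G) v :=
  if (ends e).1 == v then (ends e).2 else (ends e).1.

Definition neighbours (G : mgraph) (M : {set edge G}) v : {set vertex G} :=
  [set other_end e v | e in star M v].

Lemma incident_join (G : mgraph) (e : edge G) v : incident e v -> join [set e] v (other_end e v).
Proof.
move=> inc; rewrite /other_end; have := join1 e.
case: eqP => [->|n] //; move: inc; rewrite /incident => /orP [/eqP //|/eqP ->].
exact: join_sym.
Qed.

(* As in Sebo's proof of Seymour's theorem on T-joins: a path of minimum weight ends in a
   vertex with exactly one edge of J, and contracting the star of that vertex keeps J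
   conservative. *)
Section MinimumPath.
Variables (G : mgraph) (M J : {set edge G}).
Hypothesis JM : J \subset M.
Hypothesis consJ : conservative M J.
Implicit Types X Y : {set edge G}.

Lemma exists_minimum_path : J != set0 ->
  exists x0 b (P : {set edge G}),
    [/\ P \subset M, join P x0 b, x0 != b &
    forall x y (Q : {set edge G}), Q \subset M -> join Q x y ->
      (weight J P <= weight J Q)%R /\ (weight J Q = weight J P -> #|P| <= #|Q|)].
Proof.
case/set0Pn => j jJ.
pose good (t : vertex G * vertex G * {set edge G}) :=
  (t.2 \subset M) && [forall w, par t.2 w == (w == t.1.1) (+) (w == t.1.2)].
(* The lexicographic order by weight, then by size, as one natural number; the summand [#|edge G|]
   keeps the subtraction from being truncated. *)
pose key (t : vertex G * vertex G * {set edge G}) :=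
  (#|edge G| + #|t.2 :\: J| - #|t.2 :&: J|) * #|edge G|.+1 + #|t.2|.
have goodP x y (Q : {set edge G}) : Q \subset M -> join Q x y -> good (x, y, Q).
  by move=> s h; rewrite /good s; apply/forallP => w; rewrite h.
have gj := goodP _ _ _ (subset_trans _ JM) (join1 j).
have {gj} gj : good ((ends j).1, (ends j).2, [set j]) by apply: gj; rewrite sub1set.
case: (@arg_minnP _ _ good key gj) => -[[x0 b] P] /andP [/= PM /forallP jP] minP.
have jnP : join P x0 b by move=> w; apply/eqP/jP.
have mn x y (Q : {set edge G}) : Q \subset M -> join Q x y ->
      (weight J P <= weight J Q)%R /\ (weight J Q = weight J P -> #|P| <= #|Q|).
  move=> s h; have := minP _ (goodP _ _ _ s h); rewrite /key /= !weightE.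
  have := max_card (P :&: J); have := max_card (Q :&: J).
  have := max_card P; have := max_card Q.
  move: #|P| #|Q| #|P :&: J| #|Q :&: J| #|P :\: J| #|Q :\: J| #|edge G|.
  by move=> p q a b' c d n *; split; nia.
(* With equal ends P would be even and of weight at least 0, whereas a single edge of J is a join of
   weight -1. *)
exists x0, b, P; split => //; apply/eqP => xb; subst b.
have jM : [set j] \subset M by rewrite sub1set (subsetP JM).
have [h _] := mn _ _ _ jM (join1 j); move: h (consJ PM (join_even jnP)).
by rewrite weight1 jJ; lia.
Qed.

Variable side : vertex G -> bool.
Hypothesis bip : forall e, e \in M -> side (ends e).1 != side (ends e).2.

Variables (x0 b : vertex G) (P : {set edge G}).
Hypothesis PM : P \subset M.
Hypothesis joinP : join P x0 b.
Hypothesis x0b : x0 != b.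
Hypothesis minP : forall x y (Q : {set edge G}), Q \subset M -> join Q x y ->
  (weight J P <= weight J Q)%R /\ (weight J Q = weight J P -> #|P| <= #|Q|).

(** Removing X keeps the ends and does not raise the weight, so the second criterion, the size,
    forces X to be empty. *)
Lemma minimum_path_acyclic X : X \subset P -> even_set X -> X = set0.
Proof.
move=> sX evX.
have XM := subset_trans sX PM.
have jD : join (P :\: X) x0 b by rewrite -symd_sub //; exact: join_symd_even.
have [h1 h2] := minP (subset_trans (subsetDl _ _) PM) jD.
have h3 := consJ XM evX; move: h1 h2; rewrite weightD // => h1 h2.
have /h2 : (weight J P - weight J X = weight J P)%R by move: h1 h3; clear; lia.
rewrite cardsD (setIidPr sX).
have := subset_leq_card sX => h4 h5; apply/eqP; rewrite -cards_eq0; move: h4 h5; clear; lia.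
Qed.

Lemma bip_other_end e v : e \in M -> incident e v -> side (other_end e v) = ~~ side v.
Proof.
move=> /bip h; rewrite /incident /other_end.
case: eqP => [<- _|_ /= /eqP <-]; first by move: h; case: (side _); case: (side _).
by move: h; case: (side _); case: (side _).
Qed.

Lemma bip_even_card X : X \subset M -> even_set X -> ~~ odd #|X|.
Proof.
move=> sX evX; have := even_cut [set v | side v] evX.
suff -> : X :&: cut [set v | side v] = X by move=> ->.
apply/setIidPl/subsetP => e eX; rewrite !inE.
by have := bip (subsetP sX _ eX); case: (side _); case: (side _).
Qed.

(** Toggling an edge e at b in P only moves the end b along e. Deleting an edge outside J, or adding
    one of J, would lower the weight. *)
Lemma star_minimum_path e : e \in star M b -> (e \in P) = (e \in J).
Proof.
rewrite inE => /andP [eM inc]; have je := incident_join inc.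
have jP := join_trans joinP je.
case eP: (e \in P); case eJ: (e \in J) => //.
  have sP : [set e] \subset P by rewrite sub1set.
  move: jP; rewrite symd_sub // => jP.
  have [h1 h2] := minP (subset_trans (subsetDl _ _) PM) jP.
  by move: h1; rewrite weightD // weight1 eJ; clear; lia.
have d : [disjoint P & [set e]] by rewrite disjoint_sym disjoints1 eP.
move: jP; rewrite symd_disjoint // => jP.
have sP : P :|: [set e] \subset M by rewrite subUset PM sub1set.
have [h1 h2] := minP sP jP.
by move: h1; rewrite weightU // weight1 eJ; clear; lia.
Qed.

(** By [star_minimum_path] the edges of J at b are those of P. Two of them, f and g, would leave b
    odd in the rest of P, and the part of P from b to another odd vertex would close up to a
    nonempty even set inside P. *)
Lemma star_single : exists2 f, f \in star M b & star M b :&: J = [set f].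
Proof.
have [f fP incf] : exists2 f, f \in P & incident f b.
  by apply: par_incident; rewrite joinP eqxx eq_sym (negbTE x0b).
have fS : f \in star M b by rewrite inE incf (subsetP PM).
exists f => //; apply/eqP; rewrite eqEsubset sub1set inE fS -star_minimum_path // fP !andbT.
apply/subsetP => g; rewrite in_setI in_set1 => /andP [gS]; rewrite -star_minimum_path // => gP.
apply/eqP; apply: contraTeq isT => gf.
have incg : incident g b by move: gS; rewrite inE => /andP [].
have s2 : [set f; g] \subset P by rewrite subUset !sub1set fP.
have d : [disjoint [set f] & [set g]] by rewrite disjoints1 inE eq_sym.
have jf := incident_join incf; have jg := incident_join incg.
have nb e : e \in star M b -> other_end e b != b.
  rewrite inE => /andP [eM inc]; have := bip_other_end eM inc.
  by apply: contra_eqN => /eqP ->; case: (side b).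
have pD w : par (P :\: [set f; g]) w =
    (w == x0) (+) (w == b) (+) ((w == other_end f b) (+) (w == other_end g b)).
  rewrite par_setD // joinP par_setU // jf jg.
  by case: (w == x0); case: (w == b); case: (w == other_end f b); case: (w == other_end g b).
have ob : par (P :\: [set f; g]) b.
  by rewrite pD eqxx ![b == _]eq_sym (negbTE x0b) !(negbTE (nb _ _)).
have [v [K [vb pv sK jK]]] := odd_pair_join ob.
have sKP : K \subset P := subset_trans sK (subsetDl _ _).
have fK : f \notin K by apply/negP => /(subsetP sK); rewrite !inE eqxx.
have gK : g \notin K by apply/negP => /(subsetP sK); rewrite !inE eqxx orbT.
have close e : e \in P -> e \notin K -> incident e b -> v = other_end e b -> False.
  move=> eP eK ince ve; have ev : even_set (symd K [set e]).
    by apply: even_joins jK _; rewrite ve; exact: incident_join.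
  have := minimum_path_acyclic _ ev; rewrite symd_subset ?sub1set // => /(_ isT) /setP /(_ e).
  by rewrite !inE eqxx (negbTE eK).
move: pv; rewrite pD (negbTE vb).
case: (v =P x0) => [vx _|_].
  have ev : even_set (P :\: K).
    by rewrite -symd_sub //; apply: even_joins joinP _; rewrite -vx; exact: join_sym.
  have := minimum_path_acyclic (subsetDl _ _) ev => /setP /(_ f).
  by rewrite !inE fP fK.
case: (v =P other_end f b) => [vf _|_]; first by have := close _ fP fK incf vf.
by case: (v =P other_end g b) => [vg _|//]; have := close _ gP gK incg vg.
Qed.

(** These X become even when the star of b is contracted, so this is conservativity of J after the
    contraction. A smallest X of negative weight would be connected and join two neighbours b1, b2
    of b; closed up through b it is an even set Y of weight 0. The path P must run into X, and its
    first piece, together with one of the two parts of Y, is an even set of negative weight. *)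
Lemma star_deletion_weight n X : #|X| <= n -> X \subset M :\: star M b ->
  (forall v, v \notin neighbours M b -> par X v = false) -> (0 <= weight J X)%R.
Proof.
elim: n X => [|n IH] X.
  by rewrite leqn0 cards_eq0 => /eqP ->; rewrite weight0.
move=> Xn sX pX.
have sXM : X \subset M := subset_trans sX (subsetDl _ _).
case: (boolP (even_set X)) => [/(consJ sXM) //|].
rewrite negb_forall => /existsP [b1]; rewrite negbK => pb1.
have nbr v : par X v -> v \in neighbours M b by apply: contraLR => /pX ->.
have [b2 [K [b21 pb2 sK jK]]] := odd_pair_join pb1.
have b1N := nbr _ pb1; have b2N := nbr _ pb2.
have proper (K' : {set edge G}) : K' \subset X -> join K' b1 b2 -> K' != X -> (0 <= weight J X)%R.
  move=> sK' jK' nK'.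
  have outK v : v \notin neighbours M b -> par K' v = false.
    move=> vN; rewrite jK'; case: eqP => [vb|_]; first by rewrite vb b1N in vN.
    by case: eqP => [vb|//]; rewrite vb b2N in vN.
  have : K' \proper X by rewrite properEneq nK'.
  move=> /proper_card cK.
  have K'0 : K' != set0 by apply: (join_nonempty jK'); rewrite eq_sym.
  have cK0 : 0 < #|K'| by rewrite card_gt0.
  have w1 : (0 <= weight J K')%R.
    by apply: (IH K' _ (subset_trans sK' sX) outK); move: cK Xn; clear; lia.
  have : (0 <= weight J (X :\: K'))%R.
    apply: IH; first by rewrite cardsD (setIidPr sK'); move: cK0 Xn; clear; lia.
      exact: subset_trans (subsetDl _ _) sX.
    by move=> v vN; rewrite par_setD // pX // outK.
  by move: w1; rewrite weightD //; clear; lia.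
have [KX|] := eqVneq K X; last exact: proper.
subst K; move=> {sK}.
have [|cX] := eqVneq (component_edges X b1) X; last first.
  by apply: proper cX; [exact: component_edges_sub | exact: component_edges_join].
move=> cX.
rewrite leNgt; apply/negP => wX.
have [f1 f1S b1f] := imsetP b1N; have [f2 f2S b2f] := imsetP b2N.
have [f1M f1i] : f1 \in M /\ incident f1 b by move: f1S; rewrite inE => /andP.
have [f2M f2i] : f2 \in M /\ incident f2 b by move: f2S; rewrite inE => /andP.
have jf1 := incident_join f1i; have jf2 := incident_join f2i.
rewrite -b1f in jf1; rewrite -b2f in jf2.
have f12 : f1 != f2 by apply: contraNneq b21 => ff; rewrite b1f b2f ff.
have notX f : f \in star M b -> f \notin X.
  by move=> fS; apply/negP => /(subsetP sX); rewrite inE fS.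
have f1X := notX _ f1S; have f2X := notX _ f2S.
have d1 : [disjoint X & [set f1]] by rewrite disjoint_sym disjoints1.
have jX1 : join (X :|: [set f1]) b b2.
  rewrite -symd_disjoint // symdC; exact: join_trans jf1 jK.
have d2 : [disjoint X :|: [set f1] & [set f2]].
  by rewrite disjoint_sym disjoints1 !inE negb_or eq_sym f12 f2X.
pose Y := X :|: [set f1] :|: [set f2].
have evY : even_set Y.
  by rewrite /Y -symd_disjoint //; exact: even_joins jX1 jf2.
have sY : Y \subset M by rewrite !subUset sXM !sub1set f1M.
have wY : weight J Y = (weight J X + weight J [set f1] + weight J [set f2])%R.
  by rewrite /Y !weightU.
(* Y has an even number of edges, so its weight is even and not negative; f1 and f2 add at most 2,
   which leaves only -2 for a negative weight of X. *)
have [wX2 f1J f2J] : [/\ weight J X = (-2)%R, f1 \notin J & f2 \notin J].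
  have w0 := consJ sY evY; have ev := bip_even_card sY evY.
  have cY := cardsID J Y; have wYE := weightE J Y.
  have : (weight J Y = (#|Y| : int) - (#|Y :&: J| : int) *+ 2)%R by move: cY wYE; clear; lia.
  by move: w0; rewrite wY !weight1; case: (f1 \in J); case: (f2 \in J) => w0 h; split=> //; move: w0 h wX ev; clear; lia.
have f1P : f1 \notin P by rewrite star_minimum_path.
have f2P : f2 \notin P by rewrite star_minimum_path.
(* Otherwise P continued through f1 and X would be a join of weight one less than P. *)
have PX : P :&: X != set0.
  apply/eqP => PX0.
  have jQ := join_trans joinP jX1.
  have sQ : symd P (X :|: [set f1]) \subset M by rewrite symd_subset // subUset sXM sub1set.
  have [h _] := minP sQ jQ; move: h; rewrite weight_symd weightU // weight1 (negbTE f1J) wX2.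
  have -> : P :&: (X :|: [set f1]) = set0.
    rewrite setIUr PX0 set0U; apply/setP => e; rewrite !inE.
    by case: (e =P f1) => [->|]; rewrite ?andbF // (negbTE f1P).
  by rewrite weight0; clear; lia.
have Xb e : e \in X -> ~~ incident e b.
  move=> eX; have /setDP [eM] := subsetP sX _ eX.
  by rewrite inE eM.
have pbX : par X b = false.
  by apply/negbTE/negP => /par_incident [e /Xb /negP].
have ob : par (P :\: X) b.
  have -> : P :\: X = P :\: (P :&: X) by rewrite setDIr setDv set0U.
  rewrite par_setD ?subsetIl // joinP eqxx eq_sym (negbTE x0b) /=.
  apply/negP => /par_incident [e /setIP [_ /Xb /negP]]. by [].
(* P1 is a piece of P outside X from b to another odd vertex z of the rest; z differs from x0 and
   therefore lies on X. *)
have [z [P1 [zb pz sP1 jP1]]] := odd_pair_join ob.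
have sP1P : P1 \subset P := subset_trans sP1 (subsetDl _ _).
have P1X : [disjoint P1 & X].
  by rewrite disjoint_sym disjoints_subset; apply/subsetP => e eX; rewrite inE; apply/negP => /(subsetP sP1); rewrite inE eX.
have jD : join (P :\: P1) x0 z.
  rewrite -symd_sub //; exact: join_trans joinP jP1.
have [zx|zx] := eqVneq z x0.
  subst z; have := minimum_path_acyclic (subsetDl _ _) (join_even jD).
  move=> /setP D0; case/set0Pn: PX => e /setIP [eP eX].
  have := D0 e; rewrite inE eP andbT inE => /negbFE eP1.
  by move: P1X => /pred0P /(_ e); rewrite /= eP1 eX.
have [e eX ez] : exists2 e, e \in X & incident e z.
  case: (pickP [pred e | (e \in X) && incident e z]) => [e /andP [? ?]|h0]; first by exists e.
  move: pz; have -> : P :\: X = P :\: (P :&: X) by rewrite setDIr setDv set0U.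
  rewrite par_setD ?subsetIl // joinP (negbTE zb) (negbTE zx) /= => /par_incident [e /setIP [_ eX] ez].
  by have := h0 e; rewrite /= eX ez.
have P10 : P1 != set0 by apply: (join_nonempty jP1); rewrite eq_sym.
(* Dropping P1 leaves a join with fewer edges, which by the choice of P must have strictly larger
   weight. *)
have wP1 : (weight J P1 < 0)%R.
  have [h1 h2] := minP (subset_trans (subsetDl _ _) PM) jD.
  move: h1 h2; rewrite weightD // => h1 h2.
  rewrite ltNge; apply/negP => h3.
  have eq : (weight J P - weight J P1 = weight J P)%R by move: h1 h3; clear; lia.
  have := h2 eq; rewrite cardsD (setIidPr sP1P); have := subset_leq_card sP1P.
  by move: P10; rewrite -card_gt0; clear; lia.
have zc : connect (adj X) b1 z.
  have : e \in component_edges X b1 by rewrite cX.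
  rewrite inE eX /= => e1; have := e1; rewrite (component_ends _ eX) => e2.
  by case/orP: ez => /eqP <-; [move: e1 | move: e2]; rewrite inE.
have [X1 sX1 jX1z] := connect_join zc.
have sX1M := subset_trans sX1 sXM.
have dd : [disjoint X1 & [set f1]] by rewrite disjoint_sym disjoints1; apply: contra f1X; apply/subsetP.
have jY1 : join (X1 :|: [set f1]) b z.
  by rewrite -symd_disjoint // symdC; exact: join_trans jf1 jX1z.
pose Y1 := X1 :|: [set f1].
have sY1 : Y1 \subset Y by apply: subset_trans (subsetUl _ [set f2]); exact: setSU.
have jY2 : join (Y :\: Y1) b z.
  by rewrite -symd_sub // symdC; exact: join_symd_even.
have dP f : f \in Y -> f \notin P1.
  rewrite !inE -orbA => /or3P [fX|/eqP ->|/eqP ->].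
  - by apply/negP => fP1; move: P1X => /pred0P /(_ f); rewrite /= fP1 fX.
  - by apply: contra f1P; apply/subsetP.
  - by apply: contra f2P; apply/subsetP.
have key (Z : {set edge G}) : Z \subset Y -> join Z b z -> (0 <= weight J P1 + weight J Z)%R.
  move=> sZ jZ.
  have d : [disjoint P1 & Z].
    by rewrite disjoint_sym disjoints_subset; apply/subsetP => f /(subsetP sZ) /dP; rewrite inE.
  rewrite -weightU // -symd_disjoint //; apply: consJ; last exact: even_joins.
  by rewrite symd_subset ?(subset_trans sP1P) ?(subset_trans sZ).
(* The weights of the two joins of b and z inside Y add up to 0, so P1 with one of them has negative
   weight. *)
have k1 := key _ sY1 jY1; have k2 := key _ (subsetDl _ _) jY2.
move: k2 k1 wP1; rewrite weightD // wY wX2 !weight1 (negbTE f1J) (negbTE f2J); clear; lia.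
Qed.

End MinimumPath.

(** * Contracting the star of a vertex in a bipartite graph *)

Section Contraction.
Variables (G : mgraph) (M : {set edge G}) (side : vertex G -> bool) (b : vertex G).
Hypothesis bip : forall e, e \in M -> side (ends e).1 != side (ends e).2.
Implicit Types (X : {set edge G}) (e : edge G) (u v w : vertex G).

Let N := neighbours M b.

Definition collapse v := if v \in N then b else v.

(** The types of vertices and edges are kept, so edge sets need no translation: absorbed neighbours
    stay behind as isolated vertices, and the edges of the star become loops at b. *)
Definition contraction : mgraph :=
  MGraph (fun e => (collapse (ends e).1, collapse (ends e).2)).

Lemma par_bip X v : X \subset M -> par X v = odd #|star X v|.
Proof.
move=> sX; rewrite /par -sum1_card (big_morph odd oddD (erefl _)) /=.
rewrite big_mkcond [RHS]big_mkcond; apply: eq_bigr => e _.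
rewrite inE; case eX: (e \in X) => //=; rewrite /incident.
have := bip (subsetP sX _ eX).
by case: ((ends e).1 =P v) => [->|_]; case: ((ends e).2 =P v) => [->|_] //=; rewrite eqxx.
Qed.

Lemma neighboursP v : reflect (exists e, [/\ e \in M, incident e b, incident e v & v != b]) (v \in N).
Proof.
apply: (iffP imsetP) => [[e eS ->]|[e [eM ib iv vb]]].
  move: eS; rewrite inE => /andP [eM ib]; exists e; split => //.
    by rewrite /other_end /incident; case: ifP => _; rewrite eqxx ?orbT.
  by apply/eqP => h; have := bip_other_end bip eM ib; rewrite h; case: (side b).
exists e; first by rewrite inE eM ib.
move: ib iv; rewrite /incident /other_end.
case: eqP => [-> _|_ /= /eqP ->]; first by rewrite eq_sym (negbTE vb) => /= /eqP ->.
by rewrite [b == v]eq_sym (negbTE vb) orbF => /eqP ->.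
Qed.

Lemma neighbours_side v : v \in N -> side v = ~~ side b.
Proof.
move=> /imsetP [e]; rewrite inE => /andP [eM ib] ->.
exact: (bip_other_end bip eM ib).
Qed.

Lemma center_notin_neighbours : b \notin N.
Proof. by apply/negP => /neighbours_side; case: (side b). Qed.

Lemma par_contraction X (w : vertex contraction) :
  par (G := contraction) X w = \big[addb/false]_(v | collapse v == w) par X v.
Proof.
rewrite /par exchange_big /=; apply: eq_bigr => e _.
rewrite big_split /=.
have one a : \big[addb/false]_(v | collapse v == w) (a == v) = (collapse a == w).
  case aw: (collapse a == w); last first.
    rewrite big1 // => v vw; apply: contraFF aw => /eqP -> //.
  by rewrite (bigD1 a) //= eqxx big1 // => v /andP [_ va]; rewrite eq_sym (negbTE va).
by rewrite !one.
Qed.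

Lemma collapse_star e : e \in star M b -> collapse (ends e).1 = b /\ collapse (ends e).2 = b.
Proof.
rewrite inE => /andP [eM ib].
have h v : incident e v -> collapse v = b.
  move=> iv; rewrite /collapse; case: ifP => // /negP nN.
  apply/eqP; apply: contraT => vb; exfalso; apply: nN; apply/neighboursP; exists e; split=> //.
by split; apply: h; rewrite /incident eqxx ?orbT.
Qed.

Lemma even_contraction X : even_set X -> even_set (G := contraction) (X :\: star M b).
Proof.
move=> /even_setP ev; apply/even_setP => w.
have := par_contraction X w; rewrite [RHS]big1 => [<-|v _]; last exact: ev.
rewrite /par big_mkcond [RHS]big_mkcond; apply: eq_bigr => e _.
rewrite !inE; case eS: (e \in star M b); move: (eS); rewrite inE => -> /=; last by [].
by case: ifP => // _; have [-> ->] := collapse_star eS; rewrite addbb.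
Qed.

Lemma bridgeless_contraction :
  bridgeless M -> bridgeless (G := contraction) (M :\: star M b).
Proof.
move=> br e /setDP [eM eS]; have [Y [ev sY eY]] := br e eM.
exists (Y :\: star M b); split; first exact: even_contraction.
  exact: setSD.
by rewrite in_setD eS eY.
Qed.

Lemma contraction_parity X v : X \subset M :\: star M b ->
  even_set (G := contraction) X -> v \notin N -> par X v = false.
Proof.
move=> sX /even_setP ev vN.
have [->|vb] := eqVneq v b.
  apply/negbTE/negP => /par_incident [e /(subsetP sX) /setDP [eM]].
  by rewrite inE eM => /negP.
have := ev v; rewrite par_contraction (bigD1 v) /= ?big1 ?addbF //.
  move=> u /andP []; rewrite /collapse; case: ifP => _ /eqP h; last by rewrite h eqxx.
  by rewrite h eqxx in vb.
by rewrite /collapse (negbTE vN).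
Qed.

Let incident' e (v : vertex G) := incident (G := contraction) e v.

Lemma incident_collapse e v : incident' e v = (collapse (ends e).1 == v) || (collapse (ends e).2 == v).
Proof. by []. Qed.

Lemma star_contraction_neighbour X v : v \in N -> star (G := contraction) X v = set0.
Proof.
move=> vN; apply/setP => e; rewrite !inE.
have h u : (collapse u == v) = false.
  rewrite /collapse; apply/negbTE; case: ifP => uN.
    by apply: contraNneq center_notin_neighbours => ->.
  by apply: contraFneq uN => ->.
by rewrite -/(incident' e v) incident_collapse !h andbF.
Qed.

Lemma star_contraction_other X v : X \subset M -> v \notin N -> v != b ->
  star (G := contraction) (X :\: star M b) v = star X v.
Proof.
move=> sX vN vb; apply/setP => e.
have h u : (collapse u == v) = (u == v).
  rewrite /collapse; case: ifP => uN //; rewrite [b == v]eq_sym (negbTE vb); apply/esym/negbTE.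
  by apply: contraNneq vN => <-.
have {}h : incident' e v = incident (G := G) e v by rewrite incident_collapse !h.
rewrite inE [in RHS]inE in_setD -/(incident' e v) h inE.
case eX: (e \in X); case iv: (incident (G := G) e v); rewrite ?andbF ?andbT //=.
apply/negP => /andP [eM ib]; case: (negP vN); apply/neighboursP; exists e; split => //.
Qed.

(** All neighbours of b lie on one side, so an edge has at most one end among them; it is then
    either in the star of b or at the merged vertex. *)
Lemma star_contraction_center X : X \subset M ->
  #|star (G := contraction) (X :\: star M b) b| + #|X :&: star M b| = \sum_(u in N) #|star X u|.
Proof.
move=> sX.
have -> : \sum_(u in N) #|star X u| = \sum_(e in X) #|[set u in N | incident e u]|.
  under eq_bigr => u _ do rewrite -sum1dep_card.
  under [RHS]eq_bigr => e _ do rewrite -sum1dep_card.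
  rewrite (exchange_big_dep (mem X)) /= => [|u e _ /andP [] //].
  by apply: eq_bigr => e eX; apply: eq_bigl => u; rewrite eX.
have -> : \sum_(e in X) #|[set u in N | incident e u]| =
    \sum_(e in X) [exists u in N, incident e u].
  apply: eq_bigr => e eX; case: existsP => [[u /andP [uN iu]]|h] /=; last first.
    apply: eq_card0 => u; rewrite inE; apply/negP => h2; apply: h; by exists u.
  apply/eqP/cards1P; exists u; apply/setP => v; rewrite !inE.
  apply/andP/eqP => [[vN iv]|->] //.
  have := bip (subsetP sX _ eX); move: iu iv; rewrite /incident.
  have su := neighbours_side uN; have sv := neighbours_side vN.
  move=> /orP [/eqP h1|/eqP h1] /orP [/eqP h2|/eqP h2]; rewrite ?h1 ?h2 ?su ?sv ?eqxx //.
  - by rewrite -h1.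
  - by rewrite -h1.
have <- : #|[set e in X | [exists u in N, incident e u]]| = \sum_(e in X) [exists u in N, incident e u].
  rewrite -sum1dep_card big_mkcondr /=; apply: eq_bigr => e _; by case: ifP.
rewrite -(cardsID (star M b) [set e in X | _]) addnC; congr (_ + _).
  apply: eq_card => e; rewrite in_setI [in RHS]in_setI; case eS: (e \in star M b); rewrite ?andbF //.
  rewrite !andbT inE; case eX: (e \in X) => //=; apply/esym/existsP.
  exists (other_end e b); apply/andP; split; first exact: imset_f.
  by rewrite /other_end /incident; case: ifP => _; rewrite eqxx ?orbT.
apply: eq_card => e; rewrite inE [in RHS]in_setD in_setD; case eS: (e \in star M b) => //=.
rewrite [in RHS]inE; case eX: (e \in X) => //=.
rewrite -/(incident' e b) incident_collapse.
have eM := subsetP sX _ eX.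
have ib : incident (G := G) e b = false by move: eS; rewrite inE eM.
apply/orP/existsP => [|[u /andP [uN]]].
  have hh v : incident (G := G) e v -> collapse v == b -> exists x, (x \in N) && incident (G := G) e x.
    move=> iv; rewrite /collapse; case: ifP => [vN _|_ /eqP vb]; first by exists v; rewrite vN.
    by move: iv; rewrite vb ib.
  by case=> /(hh _) h; apply: h; rewrite /incident eqxx ?orbT.
by case/orP => /eqP ->; rewrite /collapse uN eqxx; [left|right].
Qed.

End Contraction.

(* val v stands for the number of vertices of the cubic graph merged into v minus the number of
   stars contracted in forming v. Initially side marks the vertices as opposed to the
   subdivision points. The parity clause absorbs the cuts of size two: a node of even degree
   off side with a single edge of J has odd, hence positive, val. *)
Definition admissible (G : mgraph) (M J : {set edge G}) (side : vertex G -> bool)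
    (val : vertex G -> int) : Prop :=
  forall v, odd (absz (val v)) = odd #|star M v| (+) (~~ side v && odd #|star J v|) /\
    (if side v then ((#|star M v| : int) <= val v *+ 3)%R else (0 <= val v)%R).

Lemma odd_distn (m n : nat) : odd (absz (m%:Z - n%:Z)%R) = odd m (+) odd n.
Proof.
by case: (leqP m n) => [h|/ltnW h]; [rewrite distnEr // oddB // addbC | rewrite distnEl // oddB].
Qed.

Lemma odd_abszD (x y : int) : odd (absz (x + y)%R) = odd (absz x) (+) odd (absz y).
Proof.
have diff (z : int) : exists m n : nat, z = (m%:Z - n%:Z)%R.
  by case: z => n; [exists n, 0; rewrite subr0 | exists 0, n.+1; rewrite sub0r NegzE].
have [a [b ->]] := diff x; have [c [d ->]] := diff y.
have -> : (a%:Z - b%:Z + (c%:Z - d%:Z) = (a + c)%N%:Z - (b + d)%N%:Z)%R.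
  by rewrite !PoszD opprD addrACA.
by rewrite !odd_distn !oddD; case: (odd a); case: (odd b); case: (odd c); case: (odd d).
Qed.

Lemma odd_absz_sum (I : finType) (A : {set I}) (f : I -> int) (g : I -> nat) :
  (forall i, i \in A -> odd (absz (f i)) = odd (g i)) ->
  odd (absz (\sum_(i in A) f i)%R) = odd (\sum_(i in A) g i)%N.
Proof.
move=> h; apply: (big_ind2 (fun (a : int) (c : nat) => odd (absz a) = odd c)) => //.
by move=> a c a' c' h1 h2; rewrite odd_abszD oddD h1 h2.
Qed.

(** Contracting a star with a single edge of J lowers both sides by one. The merged vertex lies on
    the side opposite to b and gets the values of b and of its neighbours, minus one; the work is to
    show that the data stay admissible. *)
Lemma admissible_bound (G : mgraph) (M J : {set edge G}) (side : vertex G -> bool) (val : vertex G -> int) :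
  J \subset M -> conservative M J -> bridgeless M ->
  (forall e, e \in M -> side (ends e).1 != side (ends e).2) ->
  admissible M J side val ->
  ((#|J| : int) <= \sum_v val v)%R.
Proof.
move En: #|J| => n; elim: n G M J side val En => [|n IH] G M J side val En JM cons br bip adm.
  apply: sumr_ge0 => v _; have [_] := adm v; case: ifP => _; last by [].
  by move: (val v) #|star M v| => a c; lia.
have J0 : J != set0 by rewrite -card_gt0 En.
have [x0 [b [P [PM joinP x0b minP]]]] := exists_minimum_path JM cons J0.
have [f fS starJ] := star_single cons bip PM joinP x0b minP.
have del := star_deletion_weight cons bip PM joinP x0b minP.
set S := star M b in fS starJ del *; set N := neighbours M b in del *.
have fJ : f \in J by have := set11 f; rewrite -starJ inE => /andP [].
pose G' := contraction M b.
pose M' : {set edge G'} := M :\: S; pose J' : {set edge G'} := J :\: S.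
pose side' (v : vertex G') := if v == b then ~~ side b else side v.
pose val' (v : vertex G') : int :=
  if v == b then (val b + \sum_(u in N) val u - 1)%R else if v \in N then 0%R else val v.
have bN : b \notin N := center_notin_neighbours b bip.
have cJ' : #|J'| = n.
  by have := cardsID S J; rewrite setIC starJ cards1 En add1n => -[].
have JM' : J' \subset M' by exact: setSD.
have cons' : conservative M' J'.
  move=> X sX ev; have w := del _ _ (leqnn _) sX (fun v => @contraction_parity G M b X v sX ev).
  suff -> : weight J' X = weight (G := G) J X by exact: w.
  apply: eq_bigr => e eX; rewrite in_setD.
  by have /setDP [_ ->] := subsetP sX _ eX.
have br' : bridgeless M' by exact: (bridgeless_contraction bip br).
have bip' e : e \in M' -> side' (ends e).1 != side' (ends e).2.
  move=> /setDP [eM]; rewrite inE eM /= => ib.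
  have h v : incident (G := G) e v -> side' (collapse M b v) = side v.
    move=> iv; rewrite /collapse /side'; rewrite -/N; case vN: (v \in N).
      by rewrite eqxx (neighbours_side bip vN).
    by case: eqP => // vb; rewrite -vb iv in ib.
  by rewrite !h ?bip // /incident eqxx ?orbT.
have dM : #|star M' b| + #|S| = \sum_(u in N) #|star M u|.
  rewrite -(star_contraction_center b bip (subxx M)) -/S; congr (_ + _).
  by congr #|pred_of_set _|; apply/esym/setIidPr/subsetP => e; rewrite inE => /andP [].
have dJ : #|star J' b| + 1 = \sum_(u in N) #|star J u|.
  by rewrite -(star_contraction_center b bip JM) -/S [J :&: S]setIC starJ cards1.
have sJb : #|star J b| = 1.
  rewrite -(cards1 f) -starJ; apply: eq_card => e; rewrite !inE.
  by case eJ: (e \in J); rewrite ?andbF // andbT (subsetP JM).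
(* An even subset of M through f has a second edge at b. *)
have S2 : 2 <= #|S|.
  have fM : f \in M by apply: (subsetP JM).
  have [Y [evY sY fY]] := br f fM.
  have := even_setP _ evY b; rewrite (par_bip bip b sY) => od.
  have : #|star Y b| <= #|S|.
    by apply: subset_leq_card; apply/subsetP => e; rewrite !inE => /andP [/(subsetP sY) ->].
  have : 0 < #|star Y b|.
    by apply/card_gt0P; exists f; move: fS; rewrite !inE fY => /andP [_ ->].
  by move: od; move: #|star Y b| #|S|; clear; lia.
have sideN u : u \in N -> side u = ~~ side b := fun h => neighbours_side bip h.
have adm' : admissible M' J' side' val'.
  move=> v; rewrite /side' /val'; have [->|vb] := eqVneq v b; last first.
    have [vN|vN] := boolP (v \in N).
      by rewrite !(star_contraction_neighbour bip) // cards0 andbF; case: ifP.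
    by rewrite !(star_contraction_other bip) //; exact: adm.
  have [pb vb] := adm b; rewrite sJb -/S in pb vb.
  case sb: (side b) pb vb => /= pb vb; split.
  - have od : odd (absz (\sum_(u in N) val u)%R) = odd (\sum_(u in N) (#|star M u| + #|star J u|))%N.
      by apply: odd_absz_sum => u uN; have [-> _] := adm u; rewrite (sideN _ uN) sb oddD.
    rewrite !odd_abszD od pb big_split /= -dM -dJ !oddD addbF.
    by case: (odd #|S|); case: (odd #|star M' b|); case: (odd #|star J' b|).
  (* With b on [side], 2 <= |S| <= 3 val b gives val b >= 1, which pays for the contraction. *)
  - have : (0 <= \sum_(u in N) val u)%R.
      by apply: sumr_ge0 => u uN; have [_] := adm u; rewrite (sideN _ uN) sb.
    by move: vb S2; move: (\sum_(u in N) val u)%R (val b) #|S|; clear; lia.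
  - have od : odd (absz (\sum_(u in N) val u)%R) = odd (\sum_(u in N) #|star M u|)%N.
      by apply: odd_absz_sum => u uN; have [-> _] := adm u; rewrite (sideN _ uN) sb addbF.
    rewrite !odd_abszD od pb -dM !oddD addbF.
    by case: (odd #|S|); case: (odd #|star M' b|).
  (* Merging subtracts |S| from the sum of the degrees and 3 from three times the values. Only |S| =
     2 falls short, and there parity makes val b odd, so that it contributes at least 3. *)
  - have : ((\sum_(u in N) #|star M u|)%N%:Z <= \sum_(u in N) (val u *+ 3))%R.
      rewrite -natz natr_sum; apply: ler_sum => u uN; have [_] := adm u.
      by rewrite (sideN _ uN) sb natz.
    rewrite -dM sumrMnl; move: vb S2 pb.
    by move: (\sum_(u in N) val u)%R (val b) #|star M' b| #|S|; clear; lia.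
have : ((n : int) <= \sum_(v : vertex G) val' v)%R := IH _ _ _ _ _ cJ' JM' cons' br' bip' adm'.
suff -> : (\sum_(v : vertex G) val' v = \sum_v val v - 1)%R by move: (\sum_v val v)%R; clear; lia.
rewrite (bigD1 b) //= [in RHS](bigD1 b) //= {1}/val' eqxx.
rewrite [X in (_ + X = _)%R](bigID (mem N)) [in RHS](bigID (mem N)) /=.
have -> : (\sum_(i | (i != b) && (i \in N)) val' i = 0)%R.
  by apply: big1 => u /andP [ub uN]; rewrite /val' (negbTE ub) uN.
have -> : (\sum_(i | (i != b) && (i \notin N)) val' i = \sum_(i | (i != b) && (i \notin N)) val i)%R.
  by apply: eq_bigr => u /andP [ub uN]; rewrite /val' (negbTE ub) (negbTE uN).
have -> : (\sum_(i | (i != b) && (i \in N)) val i = \sum_(i in N) val i)%R.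
  by apply: eq_bigl => u; case uN: (u \in N); rewrite ?andbF // andbT; apply: contraTneq uN => ->.
by rewrite add0r addrAC !addrA.
Qed.

Lemma card_symd (G : mgraph) (X Y : {set edge G}) :
  #|symd X Y| + #|X :&: Y| * 2 = #|X| + #|Y|.
Proof.
have -> : symd X Y = (X :\: Y) :|: (Y :\: X).
  by apply/setP => e; rewrite !inE; case: (e \in X); case: (e \in Y).
rewrite cardsU; have -> : (X :\: Y) :&: (Y :\: X) = set0.
  by apply/setP => e; rewrite !inE; case: (e \in X); case: (e \in Y).
rewrite cards0 subn0; have := cardsID Y X; have := cardsID X Y; rewrite [Y :&: X]setIC; clear; lia.
Qed.

Lemma big_pair_bool (R : Type) (idx : R) (op : Monoid.com_law idx) (T : finType)
    (F : T * bool -> R) :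
  \big[op/idx]_(h : T * bool) F h = \big[op/idx]_(e : T) op (F (e, false)) (F (e, true)).
Proof.
rewrite (eq_bigr (fun h => F (h.1, h.2))) => [|[e c] _ //].
rewrite -(pair_bigA _ (fun e c => F (e, c))) /=.
by apply: eq_bigr => e _; rewrite big_bool Monoid.mulmC.
Qed.

(** * Subdividing every edge of a cubic graph *)

Section Subdivision.
Variable G : mgraph.

Definition subdivision : mgraph :=
  @MGraph (vertex G + edge G)%type (edge G * bool)%type
    (fun h => (inl (if h.2 then (ends h.1).2 else (ends h.1).1), inr h.1)).

Definition both_halves (X : {set edge G}) : {set edge subdivision} :=
  [set h : edge G * bool | h.1 \in X].

Definition half_edges (X : {set edge subdivision}) : {set edge G} :=
  [set e | (e, false) \in X].

Lemma par_subdivision (X : {set edge subdivision}) (w : vertex subdivision) :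
  par X w = \big[addb/false]_(e : edge G)
    (((e, false) \in X) && ((inl (ends e).1 == w) (+) (inr e == w)) (+)
     ((e, true) \in X) && ((inl (ends e).2 == w) (+) (inr e == w))).
Proof.
rewrite /par big_mkcond /=.
rewrite big_pair_bool; apply: eq_bigr => e _ /=.
by case: (_ \in X); case: (_ \in X).
Qed.

(** A subdivision point has degree two, so an even set contains both halves of an edge or none. *)
Lemma even_subdivision (X : {set edge subdivision}) : even_set X ->
  X = both_halves (half_edges X) /\ even_set (half_edges X).
Proof.
move=> /even_setP ev.
have same e : ((e, true) \in X) = ((e, false) \in X).
  have := ev (inr e); rewrite par_subdivision (bigD1 e) //= big1 => [|f fe].
    by rewrite eqxx /= !andbT addbF; case: (_ \in X); case: (_ \in X).
  have -> : (inr f == inr e :> vertex G + edge G) = false by apply/negbTE; apply: contra fe => /eqP [->].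
  by rewrite /= !andbF.
split; first by apply/setP => -[e c]; rewrite !inE /=; case: c; rewrite ?same.
apply/even_setP => v; rewrite -(ev (inl v)) par_subdivision /par big_mkcond /=.
apply: eq_bigr => e _; rewrite inE same !addbF.
have h (a : vertex G) : (inl a == inl v :> vertex G + edge G) = (a == v) by [].
by rewrite !h; case: (_ \in X).
Qed.

Lemma even_both_halves (X : {set edge G}) : even_set X -> even_set (both_halves X).
Proof.
move=> /even_setP ev; apply/even_setP => w; rewrite par_subdivision.
case: w => [v|f]; last first.
  rewrite big1 // => e _; rewrite !inE /=; by case: (e \in X); case: (inr e == inr f).
apply: etrans (ev v); rewrite /par [RHS]big_mkcond; apply: eq_bigr => e _; rewrite !inE /= !addbF.
have h (a : vertex G) : (inl a == inl v :> vertex G + edge G) = (a == v) by [].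
by rewrite !h; case: (e \in X).
Qed.

Lemma card_half_sum (P : pred (edge subdivision)) :
  #|[set h | P h]| = \sum_(e : edge G) (P (e, false) + P (e, true)).
Proof.
rewrite -sum1dep_card big_mkcond /=.
rewrite big_pair_bool; apply: eq_bigr => e _ /=.
by case: (P _); case: (P _).
Qed.

Lemma card_both_halves (X : {set edge G}) : #|both_halves X| = #|X| * 2.
Proof.
rewrite /both_halves card_half_sum /= -sum1_card big_distrl /= [RHS]big_mkcond.
by apply: eq_bigr => e _; case: (e \in X).
Qed.

(** Subdivision doubles the join, and the value 1 at each old vertex and 0 at each new one is
    admissible just because old vertices have degree 3; so [admissible_bound] reads 2|Q| <= |V|. *)
Lemma cubic_min_join_card (Q : {set edge G}) : cubic G -> bridgeless [set: edge G] ->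
  (forall X : {set edge G}, even_set X -> #|Q| <= #|symd Q X|) -> #|Q| * 2 <= #|vertex G|.
Proof.
move=> cub br minQ.
pose side (w : vertex subdivision) := if w is inl _ then true else false.
pose val (w : vertex subdivision) : int := if w is inl _ then 1%R else 0%R.
have cons : conservative [set: edge subdivision] (both_halves Q).
  move=> X _ /even_subdivision [XE ev]; rewrite XE weightE.
  have -> : both_halves (half_edges X) :\: both_halves Q = both_halves (half_edges X :\: Q).
    by apply/setP => h; rewrite !inE.
  have -> : both_halves (half_edges X) :&: both_halves Q = both_halves (half_edges X :&: Q).
    by apply/setP => h; rewrite !inE.
  rewrite !card_both_halves; have := minQ _ ev; have := card_symd Q (half_edges X).
  have := cardsID Q (half_edges X); rewrite [Q :&: _]setIC.
  by move: #|half_edges X :&: Q| #|half_edges X :\: Q| #|symd _ _| #|Q| #|half_edges X|; clear; lia.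
have br' : bridgeless [set: edge subdivision].
  move=> [e c] _; have [Y [ev _ eY]] := br e (in_setT _).
  by exists (both_halves Y); split; [exact: even_both_halves | rewrite subsetT | rewrite inE].
have adm : admissible [set: edge subdivision] (both_halves Q) side val.
  case=> [v|f] /=.
    have -> : #|star [set: edge subdivision] (inl v)| = 3.
      rewrite -(cub v) /star card_half_sum /degree [RHS]big_mkcond /=; apply: eq_bigr => e _.
      have h (a : vertex G) : (inl a == inl v :> vertex G + edge G) = (a == v) by [].
      by rewrite !in_setT /incident /= !orbF !h.
    by [].
  have hf e (a : vertex G) : (inl a == inr f :> vertex G + edge G) = false by [].
  have he e : (inr e == inr f :> vertex G + edge G) = (e == f) by [].
  have -> : #|star [set: edge subdivision] (inr f)| = 2.
    rewrite /star card_half_sum (bigD1 f) //= big1 => [|e ef].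
      by rewrite !in_setT /incident /= !he eqxx ?orbT.
    by rewrite !in_setT /incident /= !he (negbTE ef).
  have -> : #|star (both_halves Q) (inr f)| = (f \in Q) * 2.
    rewrite /star card_half_sum (bigD1 f) //= big1 => [|e ef].
      by rewrite !inE /incident /= !he eqxx ?andbT; case: (f \in Q).
    by rewrite !inE /incident /= !he (negbTE ef) !andbF.
  by case: (f \in Q).
have := admissible_bound (subsetT _) cons br' _ adm.
rewrite card_both_halves => h; have {h} := h (fun _ _ => isT).
suff -> : (\sum_w val w = (#|vertex G| : int))%R by [].
rewrite big_sumType /= [X in (_ + X)%R]big1 // addr0 sumr_const natz.
by [].
Qed.

End Subdivision.

(** * The eight-flow theorem *)

Section ClosedTrail.
Variables (G : mgraph) (Y : {set edge G}).
Hypothesis brY : bridgeless Y.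
Implicit Types (P R : {set edge G}).

(** The conclusion of the edge version of Menger's theorem for two paths. *)
Definition two_joins x z := exists P1 P2 : {set edge G},
  [/\ P1 \subset Y, P2 \subset Y, [disjoint P1 & P2], join P1 x z & join P2 x z].

Lemma connect_incident P x w e : (forall e, e \in P -> (ends e).1 \in component P x) ->
  e \in P -> incident e w -> connect (adj P) x w.
Proof.
move=> cP eP; have h1 := cP _ eP; have h2 := h1; rewrite (component_ends _ eP) in h2.
by case/orP => /eqP <-; [move: h1 | move: h2]; rewrite inE.
Qed.

Lemma component_edges_comp P x e : e \in component_edges P x -> (ends e).1 \in component (component_edges P x) x.
Proof.
by rewrite inE => /andP [_ h]; rewrite inE; exact: component_edges_connect.
Qed.

(* Rerouting P1 along R through w, as in Whitney's proof of Menger's theorem. *)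
Lemma reroute x z z' w f P1 P2 R : P1 \subset Y -> P2 \subset Y -> [disjoint P1 & P2] ->
  join P2 x z -> f \in Y -> joins f z z' -> f \notin P1 -> f \notin P2 ->
  R \subset Y -> [disjoint R & P2] -> f \notin R -> join R z' w -> connect (adj P1) x w ->
  two_joins x z'.
Proof.
move=> s1 s2 d j2 fY jf f1 f2 sR dR fR jR /connect_join [Q sQ jQ].
have sQ1 := subset_trans sQ s1.
exists (symd Q R), (symd P2 [set f]); split.
- exact: symd_subset.
- by apply: symd_subset; rewrite ?sub1set.
- apply/pred0P => e; rewrite /= !inE.
  case: (e =P f) => [->|_].
    have fQ : f \notin Q by apply: contra f1; apply/subsetP.
    by rewrite (negbTE fQ) (negbTE fR).
  rewrite addbF; case e2: (e \in P2); rewrite ?andbF // andbT.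
  move: d dR => /pred0P /(_ e) /=; rewrite e2 andbT => e1 /pred0P /(_ e) /=.
  rewrite e2 andbT => ->; rewrite addbF; apply: contraFF e1; exact: (subsetP sQ).
- exact: join_trans jQ (join_sym jR).
- exact: join_trans j2 (joins_join jf).
Qed.

Lemma two_joins_sym_step x z z' f P1 P2 : P1 \subset Y -> P2 \subset Y -> [disjoint P1 & P2] ->
  join P1 x z -> join P2 x z -> f \in P1 -> joins f z z' -> two_joins x z'.
Proof.
move=> s1 s2 d j1 j2 fP jf.
have fY := subsetP s1 _ fP.
exists (symd P1 [set f]), (symd P2 [set f]); split.
- by apply: symd_subset; rewrite ?sub1set.
- by apply: symd_subset; rewrite ?sub1set.
- apply/pred0P => e; rewrite /= !inE; case: (e =P f) => [->|_]; first by rewrite fP.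
  by rewrite !addbF; exact: (pred0P d).
- exact: join_trans j1 (joins_join jf).
- exact: join_trans j2 (joins_join jf).
Qed.

(** If f is on one of the joins, it moves to the other. If not, a join R from x to z' that avoids f
    is followed backwards from z' until it meets P1 or P2; that one is rerouted along R, and the
    other is prolonged by f. *)
Lemma two_joins_step x z z' f : two_joins x z -> f \in Y -> joins f z z' -> two_joins x z'.
Proof.
case=> Q1 [Q2 [sQ1 sQ2 dQ jQ1 jQ2]] fY jf.
(* Restricted to the component of x, each join connects x to every vertex that it meets. *)
pose P1 := component_edges Q1 x; pose P2 := component_edges Q2 x.
have s1 : P1 \subset Y := subset_trans (component_edges_sub _ _) sQ1.
have s2 : P2 \subset Y := subset_trans (component_edges_sub _ _) sQ2.
have j1 : join P1 x z := component_edges_join jQ1.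
have j2 : join P2 x z := component_edges_join jQ2.
have d : [disjoint P1 & P2].
  exact: disjointW (component_edges_sub _ _) (component_edges_sub _ _) dQ.
have [f1|f1] := boolP (f \in P1); first exact: two_joins_sym_step j1 j2 f1 jf.
have [f2|f2] := boolP (f \in P2).
  by apply: two_joins_sym_step j2 j1 f2 jf => //; rewrite disjoint_sym.
have [R0 sR0 jR0] := connect_join (bridgeless_connect brY fY).
have jR0' : join R0 z z'.
  by case/orP: jf => /eqP fe; move: jR0; rewrite fe //=; exact: join_sym.
pose R := symd P1 R0.
have jR : join R x z' := join_trans j1 jR0'.
have sR : R \subset Y :\ f.
  by apply: symd_subset => //; rewrite subsetD1 s1 f1.
have sRY := subset_trans sR (subD1set _ _).
suff [w [R' [sR' jR' hw]]] : exists w (R' : {set edge G}),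
   [/\ R' \subset R :\: (P1 :|: P2), join R' z' w &
     w = x \/ exists2 e, e \in P1 :|: P2 & incident e w].
  have sR'Y : R' \subset Y := subset_trans (subset_trans sR' (subsetDl _ _)) sRY.
  have fR' : f \notin R'.
    apply/negP => /(subsetP sR'); rewrite inE => /andP [_ /(subsetP sR)].
    by rewrite !inE eqxx.
  have dis (P : {set edge G}) : P \subset P1 :|: P2 -> [disjoint R' & P].
    move=> sP; rewrite disjoint_sym disjoints_subset; apply/subsetP => e /(subsetP sP) eP.
    by rewrite inE; apply/negP => /(subsetP sR'); rewrite inE eP.
  have c1 : connect (adj P1) x w -> two_joins x z'.
    by apply: (reroute s1 s2 d j2 fY jf f1 f2 sR'Y) => //; apply: dis; exact: subsetUr.
  have c2 : connect (adj P2) x w -> two_joins x z'.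
    rewrite disjoint_sym in d.
    by apply: (reroute s2 s1 d j1 fY jf f2 f1 sR'Y) => //; apply: dis; exact: subsetUl.
  case: hw => [wx|[e]]; first by apply: c1; rewrite wx connect0.
  rewrite inE => /orP [eP|eP] inc; [apply: c1|apply: c2];
    exact: connect_incident (@component_edges_comp _ _) eP inc.
case: (pickP [pred e | (e \in P1 :|: P2) && incident e z']) => [e /andP [eP inc]|none].
  exists z', set0; split; [exact: sub0set | exact: even_join (even_set0 _) | by right; exists e].
have [->|zx] := eqVneq z' x.
  by exists x, set0; split; [exact: sub0set | exact: even_join (even_set0 _) | left].
have RD v : par (R :\: (P1 :|: P2)) v = par R v (+) par (R :&: (P1 :|: P2)) v.
  have -> : R :\: (P1 :|: P2) = R :\: (R :&: (P1 :|: P2)) by rewrite [in RHS]setDIr setDv set0U.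
  by rewrite par_setD // subsetIl.
have /odd_pair_join [w [R' [wz pw sR' jR']]] : par (R :\: (P1 :|: P2)) z'.
  rewrite RD jR eqxx (negbTE zx) /=.
  by apply/negP => /par_incident [e /setIP [_ eP] inc]; have := none e; rewrite /= eP inc.
exists w, R'; split => //.
have [->|wx] := eqVneq w x; first by left.
right; move: pw; rewrite RD jR (negbTE wx) (negbTE wz) /= => /par_incident [e /setIP [_ eP] inc].
by exists e.
Qed.

Lemma connect_two_joins x y : connect (adj Y) x y -> two_joins x y.
Proof.
case/connectP => p; elim/last_ind: p y => [|p w IH] y /=.
  by move=> _ ->; exists set0, set0; rewrite !sub0set -setI_eq0 set0I eqxx; split => //;
    exact: even_join (even_set0 _).
rewrite rcons_path last_rcons => /andP [pth /existsP [f /andP [fY jf]]] ->.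
exact: two_joins_step (IH _ pth erefl) fY jf.
Qed.

(** The union of two disjoint joins of x and y is even; its component at x is the trail. *)
Lemma closed_trail x y : connect (adj Y) x y -> exists C : {set edge G},
  [/\ C \subset Y, even_set C, connect (adj C) x y &
      forall e, e \in C -> (ends e).1 \in component C x].
Proof.
case/connect_two_joins => P1 [P2 [s1 s2 d j1 j2]].
exists (component_edges (P1 :|: P2) x); split.
- by apply: subset_trans (component_edges_sub _ _) _; rewrite subUset s1.
- apply/even_setP => v; rewrite component_edges_par -symd_disjoint //.
  by rewrite (even_setP _ (even_joins j1 j2)) andbF.
- apply: component_edges_connect; rewrite inE; apply: adj_sub (join_connect j1); exact: subsetUl.
- exact: component_edges_comp.
Qed.

End ClosedTrail.

(** * Flows outside a growing vertex set *)

Section EightFlow.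
Variables (G : mgraph) (F : {set edge G}).
Hypothesis brF : bridgeless F.
Implicit Types (A B C T X : {set edge G}) (U L S : {set vertex G}).

Definition inside U : {set edge G} := [set e | ((ends e).1 \in U) && ((ends e).2 \in U)].
Definition avoiding U : {set edge G} := [set e | ((ends e).1 \notin U) && ((ends e).2 \notin U)].

(* The union A of closed trails avoids U and takes the role of the third coordinate of a
   nowhere-zero flow with values in F_2^3 on the graph obtained by contracting U. *)
Definition flow_outside U := exists A B1 B2 : {set edge G},
  [/\ [/\ A \subset F, B1 \subset F & B2 \subset F],
      even_set A, A \subset avoiding U,
      forall v, v \notin U -> par B1 v = false /\ par B2 v = false &
      F :\: inside U \subset A :|: (B1 :|: B2)].

Lemma inside_sub U L : U \subset L -> inside U \subset inside L.
Proof.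
by move=> /subsetP s; apply/subsetP => e; rewrite !inE => /andP [/s -> /s ->].
Qed.

Lemma inside_incident U e v : e \in inside U -> v \notin U -> incident e v = false.
Proof.
rewrite inE /incident => /andP [h1 h2] vU; apply/negbTE; rewrite negb_or.
by apply/andP; split; apply: contraNneq vU => <-.
Qed.

Lemma par_inside U X v : X \subset inside U -> v \notin U -> par X v = false.
Proof.
move=> /subsetP s vU; apply/negbTE/negP => /par_incident [e /s eU].
by rewrite (inside_incident eU vU).
Qed.

Lemma par_setD_inside U X v : v \notin U -> par (X :\: inside U) v = par X v.
Proof.
move=> vU; have -> : X :\: inside U = X :\: (X :&: inside U) by rewrite setDIr setDv set0U.
by rewrite par_setD ?subsetIl // (@par_inside U (X :&: _)) ?subsetIr // addbF.
Qed.

Lemma component_inside C x U : C \subset inside U -> x \in U -> component C x \subset U.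
Proof.
move=> sC xU; apply/subsetP => v; rewrite inE => /connectP [p].
elim/last_ind: p v => [|p w IH] v /=; first by move=> _ ->.
rewrite rcons_path last_rcons => /andP [pth /existsP [e /andP [eC j]]] ->.
have := subsetP sC _ eC; rewrite inE.
by case/orP: j => /eqP -> /= /andP [].
Qed.

Section Lift.
Variables (U X : {set vertex G}) (x : vertex G) (C A B1 B2 T T1 T2 : {set edge G}).
Let U' := U :|: X.
Let new := F :&: (inside U' :\: inside U).
Let W1 := (B1 :\: inside U') :|: (new :\: (C :|: T)) :|: T1.
Let W2 := (B2 :\: inside U') :|: T2.

(** The edges of C are covered by the new A, so the other two sets may be changed freely along C. As
    C connects X, this repairs every parity on X once the total parity over X is even. T is reserved
    for adjusting the two totals, and all remaining new edges go to the first set. *)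
Lemma flow_lift :
  X = component C x -> [disjoint X & U] ->
  C \subset F -> even_set C -> C \subset inside X ->
  [/\ A \subset F, B1 \subset F & B2 \subset F] ->
  even_set A -> A \subset avoiding U' ->
  (forall v, v \notin U' -> par B1 v = false /\ par B2 v = false) ->
  F :\: inside U' \subset A :|: (B1 :|: B2) ->
  T \subset new :\: C -> T1 :|: T2 = T ->
  odd #|[set v in X | par W1 v]| = false ->
  odd #|[set v in X | par W2 v]| = false ->
  flow_outside U.
Proof.
move=> XE dXU CF evC CX [AF B1F B2F] evA avA evB cov sT TE o1 o2.
have fix_up W : ~~ odd #|[set v in X | par W v]| ->
    exists2 Y : {set edge G}, Y \subset C & forall v, v \in X -> par (symd W Y) v = false.
  move=> o; have [|Y sY jY] := @join_parity_set _ C _ x _ o.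
    by move=> v; rewrite inE XE inE => /andP [].
  by exists Y => // v vX; rewrite par_symd jY inE vX addbb.
have [Y1 sY1 jY1] := fix_up W1 (negbT o1); have [Y2 sY2 jY2] := fix_up W2 (negbT o2).
have UU' : inside U \subset inside U' := inside_sub (subsetUl _ _).
have XU' : inside X \subset inside U' := inside_sub (subsetUr _ _).
have newU' : new \subset inside U' by apply/subsetP => e; rewrite !in_setI in_setD => /and3P [].
have newF : new \subset F := subsetIl _ _.
have Tnew : T \subset new := subset_trans sT (subsetDl _ _).
have T1T : T1 \subset T by rewrite -TE subsetUl.
have T2T : T2 \subset T by rewrite -TE subsetUr.
have CU' := subset_trans CX XU'.
have disAC : [disjoint A & C].
  apply/pred0P => e /=; apply/negP => /andP [/(subsetP avA) h1 /(subsetP CU')].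
  by move: h1; rewrite !inE => /andP [/negbTE ->].
exists (A :|: C), (symd W1 Y1), (symd W2 Y2); split.
- split; first by rewrite subUset AF.
    apply: symd_subset; last exact: subset_trans CF.
    rewrite !subUset (subset_trans (subsetDl _ _) B1F) (subset_trans (subsetDl _ _) newF).
    by rewrite (subset_trans T1T) ?(subset_trans Tnew).
  apply: symd_subset; last exact: subset_trans CF.
  by rewrite subUset (subset_trans (subsetDl _ _) B2F) (subset_trans T2T) ?(subset_trans Tnew).
- by rewrite -symd_disjoint //; exact: even_symd.
- rewrite subUset; apply/andP; split; apply/subsetP => e.
    by move/(subsetP avA); rewrite !inE !negb_or => /andP [/andP [-> _] /andP [-> _]].
  move/(subsetP CX); rewrite !inE => /andP [h1 h2].
  have h v : v \in X -> v \notin U.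
    by move=> vX; apply/negP => vU; move: dXU => /pred0P /(_ v); rewrite /= vX vU.
  by rewrite !h.
- move=> v vU; have [vX|vX] := boolP (v \in X); first by rewrite jY1 ?jY2.
  have vU' : v \notin U' by rewrite inE negb_or vU.
  have [p1 p2] := evB v vU'.
  have z (Z : {set edge G}) : Z \subset inside U' -> par Z v = false.
    by move=> sZ; exact: par_inside sZ vU'.
  have zs (Z W Y : {set edge G}) : par Z v = false -> W \subset inside U' -> Y \subset inside U' ->
      par (symd ((Z :\: inside U') :|: W) Y) v = false.
    move=> pZ sW sY; rewrite par_symd par_setU; last first.
      rewrite disjoints_subset; apply/subsetP => e /setDP [_ h].
      by rewrite in_setC; apply: contra h; exact: (subsetP sW).
    by rewrite par_setD_inside // pZ !z.
  have t1 := subset_trans T1T (subset_trans Tnew newU').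
  have t2 := subset_trans T2T (subset_trans Tnew newU').
  rewrite /W1 -setUA !zs ?(subset_trans sY1) ?(subset_trans sY2) //.
  by rewrite subUset t1 (subset_trans (subsetDl _ _) newU').
- apply/subsetP => e /setDP [eF eU].
  have [eU'|eU'] := boolP (e \in inside U'); last first.
    have eC : e \notin C by apply: contra eU'; exact: (subsetP CU').
    have y1 : e \notin Y1 by apply: contra eC; exact: (subsetP sY1).
    have y2 : e \notin Y2 by apply: contra eC; exact: (subsetP sY2).
    have := subsetP cov e; rewrite in_setD eU' eF => /(_ isT).
    rewrite !in_setU ![e \in symd _ _]inE (negbTE y1) (negbTE y2) !addbF.
    rewrite !in_setU !in_setD eU' /=.
    by case/or3P => ->; rewrite ?orbT.
  have eN : e \in new by rewrite in_setI eF in_setD eU eU'.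
  have [eC|eC] := boolP (e \in C); first by rewrite !in_setU eC orbT.
  have y1 : e \notin Y1 by apply: contra eC; exact: (subsetP sY1).
  have y2 : e \notin Y2 by apply: contra eC; exact: (subsetP sY2).
  rewrite !in_setU ![e \in symd _ _]inE (negbTE y1) (negbTE y2) !addbF.
  rewrite /W1 /W2 !in_setU in_setD [e \in new :\: _]in_setD eN in_setU (negbTE eC) /=.
  have : e \in T = (e \in T1) || (e \in T2) by rewrite -TE in_setU.
  by case: (e \in T) => /=; [move/esym/orP => [->|->] | move=> _]; rewrite ?orbT.
Qed.

End Lift.


Lemma component0 (x : vertex G) : component set0 x = [set x].
Proof.
apply/setP => v; rewrite !inE; apply/idP/eqP => [/connectP [[|w p] /= h ->] //|->].
  by case/andP: h => /existsP [e]; rewrite inE.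
exact: connect0.
Qed.

Lemma cut_sub S L e : S \subset L -> e \in cut S -> e \notin inside L -> e \in cut L.
Proof.
move=> /subsetP s; rewrite !inE.
have := s (ends e).1; have := s (ends e).2; move: (ends e) => [a b] /=.
case: (a \in S); case: (b \in S); case: (a \in L); case: (b \in L) => // h1 h2;
  by [have := h1 isT | have := h2 isT].
Qed.

Lemma cut_disjoint S S' L e : S \subset L -> S' \subset L -> [disjoint S & S'] ->
  e \in cut L -> e \in cut S -> e \notin cut S'.
Proof.
move=> /subsetP s /subsetP s' /pred0P d; rewrite !inE.
have := s (ends e).1; have := s (ends e).2; have := s' (ends e).1; have := s' (ends e).2.
have := d (ends e).1; have := d (ends e).2; move: (ends e) => [a b] /=.
case: (a \in S); case: (b \in S); case: (a \in S'); case: (b \in S') => //=;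
  case: (a \in L); case: (b \in L) => //= _ _ h1 h2 h3 h4;
  by [have := h1 isT | have := h2 isT | have := h3 isT | have := h4 isT].
Qed.

(** For L disjoint from U, [inner_cut] holds the edges of F from L to the vertices outside both L
    and U, and [outer_cut] those between L and U. *)
Definition inner_cut U L := F :&: cut L :&: avoiding U.
Definition outer_cut U L := (F :&: cut L) :\: avoiding U.

Lemma outer_cutP U L e : [disjoint L & U] -> e \in outer_cut U L ->
  exists x u, [/\ x \in L, u \in U, joins e x u & e \in F].
Proof.
move=> d; have dd v : v \in L -> v \notin U.
  by move=> vL; apply/negP => vU; move: d => /pred0P /(_ v); rewrite /= vL vU.
rewrite in_setD in_setI => /and3P [na eF]; move: na; rewrite !inE negb_and !negbK => h.
case e1: ((ends e).1 \in L) => /=.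
  move=> _; exists (ends e).1, (ends e).2; split => //.
    by move: h; rewrite (negbTE (dd _ e1)).
  by rewrite /joins; case: (ends e) => a b /=; rewrite eqxx.
move=> e2; exists (ends e).2, (ends e).1; split => //.
  by move: h; rewrite (negbTE (dd _ e2)) orbF.
by rewrite /joins; case: (ends e) => a b /=; rewrite eqxx orbT.
Qed.

Lemma joins_inside e x u S U : joins e x u -> x \in S -> u \in U -> e \in inside (U :|: S).
Proof. by rewrite !inE => /orP [/eqP ->|/eqP ->] /= -> ->; rewrite ?orbT. Qed.

Lemma joins_notin_inside e x u U : joins e x u -> x \notin U -> e \notin inside U.
Proof. by rewrite !inE => /orP [/eqP ->|/eqP ->] /= /negbTE ->; rewrite ?andbF. Qed.

Lemma joins_cut e x u S : joins e x u -> x \in S -> u \notin S -> e \in cut S.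
Proof. by rewrite !inE => /orP [/eqP ->|/eqP ->] /= -> /negbTE ->. Qed.

Section Step.
Variables (U L : {set vertex G}).
Hypothesis L0 : L != set0.
Hypothesis dLU : [disjoint L & U].
Hypothesis L1 : #|inner_cut U L| <= 1.
Hypothesis minL : forall S, S \subset L -> S != set0 -> S != L -> 1 < #|inner_cut U S|.

Let notU v : v \in L -> v \notin U.
Proof. by move=> vL; apply/negP => vU; move: dLU => /pred0P /(_ v); rewrite /= vL vU. Qed.

(** A single vertex x with empty C suffices. The other vertices of L are even already, so the parity
    at x is that of the cut of L. If an edge of F joins L to U, bridgelessness and [L1] make it one
    of exactly two edges of F in this cut, and it copies the last two coordinates of the other
    one. *)
Lemma flow_step_small : #|outer_cut U L| <= 1 ->
  exists2 X : {set vertex G}, X != set0 /\ [disjoint X & U] & (flow_outside (U :|: X) -> flow_outside U).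
Proof.
move=> K1; set K := outer_cut U L in K1.
(* x is the end in L of the only edge to U; if there is none, any vertex of L serves. *)
have [x [xL xK]] : exists x, x \in L /\ forall e, e \in K -> exists2 u, u \in U & joins e x u.
  case: (set_0Vmem K) => [->|[e eK]].
    by have [x xL] := set0Pn _ L0; exists x; split => // e; rewrite inE.
  have [x [u [xL uU j _]]] := outer_cutP dLU eK; exists x; split => // f fK.
  by exists u; rewrite // (card_le1_eqP K1 _ _ eK fK).
have xU := notU xL.
exists [set x]; first by split; [apply/set0Pn; exists x; rewrite set11 | rewrite disjoints1].
case=> A [B1 [B2 [[AF B1F B2F] evA avA evB cov]]].
pose U' := U :|: [set x].
pose new := F :&: (inside U' :\: inside U).
have KF : K \subset F by apply/subsetP => e; rewrite in_setD in_setI => /and3P [].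
have Knew : K \subset new.
  apply/subsetP => e eK; have [u uU j] := xK _ eK; rewrite in_setI (subsetP KF) //= in_setD.
  by rewrite (joins_notin_inside j xU) (joins_inside j (set11 x) uU).
have newU' : new \subset inside U' by apply/subsetP => e; rewrite !in_setI in_setD => /and3P [].
have Kcut : K \subset cut [set x].
  apply/subsetP => e eK; have [u uU j] := xK _ eK; apply: (joins_cut j (set11 x)).
  by rewrite inE; apply: contraTneq uU => ->.
pose V1 := (B1 :\: inside U') :|: (new :\: (set0 :|: K)).
pose V2 := (B2 :\: inside U').
have parity V B N : V = (B :\: inside U') :|: N -> N \subset new :\: K -> B \subset F ->
    (forall v, v \notin U' -> par B v = false) ->
    odd #|V :&: cut [set x]| = odd #|V :&: cut L| /\ V :&: cut L \subset inner_cut U L.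
  move=> VE sN BF eB; split.
    rewrite -!par_cut big_set1 (bigD1 x) //= big1 ?addbF // => v /andP [vL vx].
    have vU' : v \notin U' by rewrite !inE negb_or (notU vL).
    have NU' : N \subset inside U' := subset_trans sN (subset_trans (subsetDl _ _) newU').
    rewrite VE par_setU; last first.
      rewrite disjoints_subset; apply/subsetP => e /setDP [_ h]; rewrite in_setC.
      by apply: contra h; exact: (subsetP NU').
    by rewrite par_setD_inside // eB // (par_inside NU' vU').
  apply/subsetP => e /setIP [eV eL].
  have eF : e \in F.
    move: eV; rewrite VE in_setU => /orP [/setDP [/(subsetP BF)] //|/(subsetP sN)].
    by rewrite in_setD in_setI => /and3P [].
  rewrite /inner_cut in_setI in_setI eF eL /=; apply: contraT => nav.
  have eK : e \in K by rewrite in_setD nav in_setI eF.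
  move: eV; rewrite VE in_setU => /orP [/setDP [_]|/(subsetP sN)].
    by rewrite (subsetP newU') // (subsetP Knew).
  by rewrite in_setD eK.
have [q1 s1] : odd #|V1 :&: cut [set x]| = odd #|V1 :&: cut L| /\ V1 :&: cut L \subset inner_cut U L.
  apply: parity (erefl _) _ B1F _; first by rewrite set0U.
  by move=> v /evB [].
have [q2 s2] : odd #|V2 :&: cut [set x]| = odd #|V2 :&: cut L| /\ V2 :&: cut L \subset inner_cut U L.
  apply: (@parity _ B2 set0) => //; rewrite ?setU0 ?sub0set //.
  by move=> v /evB [].
pose T1 := if odd #|V1 :&: cut [set x]| then K else set0.
pose T2 := if odd #|V2 :&: cut [set x]| then K else set0.
have even_no_inner (Z : {set edge G}) : inner_cut U L = set0 -> Z :&: cut L \subset inner_cut U L ->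
    odd #|Z :&: cut L| = false.
  by move=> ->; rewrite subset0 => /eqP ->; rewrite cards0.
have noK : K = set0 -> inner_cut U L = set0.
  move=> K0; apply/eqP; apply: contraT => /set0Pn [b bD].
  have [/setIP [bF bL] _] := setIP bD.
  have [f [fF fL fb]] := bridgeless_cut brF bF bL.
  have fD : f \in inner_cut U L.
    rewrite /inner_cut in_setI in_setI fF fL; apply: contraT => nav.
    by have : f \in K by [rewrite in_setD nav in_setI fF]; rewrite K0 inE.
  by rewrite (card_le1_eqP L1 _ _ bD fD) eqxx in fb.
have close V (T' : {set edge G}) : V :&: cut L \subset inner_cut U L ->
    odd #|V :&: cut [set x]| = odd #|V :&: cut L| -> [disjoint V & K] ->
    T' = (if odd #|V :&: cut [set x]| then K else set0) ->
    odd #|[set v in [set x] | par (V :|: T') v]| = false.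
  move=> sV qV dVK TE; rewrite odd_set_par.
  have [K0|K0] := eqVneq K set0.
    have -> : T' = set0 by rewrite TE K0; case: ifP.
    by rewrite setU0 qV (even_no_inner _ (noK K0)).
  have cK : #|K| = 1 by apply/eqP; rewrite eqn_leq K1 card_gt0.
  rewrite TE; case: ifP => q; last by rewrite setU0 q.
  rewrite setIUl (setIidPl Kcut) cardsU -setIA (setIC _ K) setIA.
  by move: dVK; rewrite -setI_eq0 => /eqP ->; rewrite set0I cards0 subn0 oddD q cK.
apply: (@flow_lift U [set x] x set0 A B1 B2 K T1 T2) => //.
- by rewrite component0.
- by rewrite disjoints1.
- exact: sub0set.
- exact: even_set0.
- exact: sub0set.
- by rewrite setD0.
- rewrite /T1 /T2; have [K0|K0] := eqVneq K set0.
    by rewrite K0; do 2 case: ifP => _; rewrite setU0.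
  case: ifP => p1; case: ifP => p2; rewrite ?setU0 ?setUid ?set0U //.
  (* If both totals were even, the other edge b of the cut would be in neither B1 nor B2, and the
     even set A cannot meet the cut in b alone. *)
  exfalso; have /set0Pn [e eK] := K0.
  have /and3P [_ eF eL] : [&& e \notin avoiding U, e \in F & e \in cut L].
    by move: eK; rewrite in_setD in_setI.
  have [b [bF bL be]] := bridgeless_cut brF eF eL.
  have bav : b \in avoiding U.
    apply: contraT => nav.
    have bK : b \in K by rewrite in_setD nav in_setI bF.
    by rewrite (card_le1_eqP K1 _ _ eK bK) eqxx in be.
  have bD : b \in inner_cut U L by rewrite /inner_cut in_setI in_setI bF bL.
  have only (Z : {set edge G}) : Z :&: cut L \subset inner_cut U L -> b \in Z -> odd #|Z :&: cut L|.
    move=> sZ bZ; rewrite (_ : Z :&: cut L = [set b]) ?cards1 //.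
    apply/eqP; rewrite eqEsubset sub1set in_setI bZ bL /= andbT; apply/subsetP => f fZ.
    by rewrite inE (card_le1_eqP L1 _ _ bD (subsetP sZ _ fZ)).
  have bU' : b \notin inside U'.
    move: bav bL; rewrite !inE => /andP [/negbTE -> /negbTE ->] /= h.
    by apply/negP => /andP [/eqP h1 /eqP h2]; move: h; rewrite h1 h2 addbb.
  have := subsetP cov b; rewrite in_setD bU' bF => /(_ isT).
  rewrite !in_setU => /or3P [bA|bB|bB].
  - have /only : A :&: cut L \subset inner_cut U L.
      apply/subsetP => f /setIP [fA fL]; rewrite /inner_cut in_setI in_setI fL (subsetP AF) //=.
      by have := subsetP avA _ fA; rewrite !inE !negb_or => /andP [/andP [-> _] /andP [-> _]].
    by rewrite (even_cut L evA) => /(_ bA).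
  - have bV : b \in V1 by rewrite in_setU in_setD bU' bB.
    by have := only _ s1 bV; rewrite -q1 p1.
  - have bV : b \in V2 by rewrite in_setD bU' bB.
    by have := only _ s2 bV; rewrite -q2 p2.
- apply: close => //; rewrite disjoints_subset; apply/subsetP => e; rewrite in_setU in_setC.
  case/orP => /setDP [_]; last by rewrite set0U.
  by apply: contra => /(subsetP Knew) /(subsetP newU').
- apply: close => //; rewrite disjoints_subset; apply/subsetP => e /setDP [_]; rewrite in_setC.
  by apply: contra => /(subsetP Knew) /(subsetP newU').
Qed.


Let Y := F :&: inside L.

Lemma component_step_cut (Z : {set edge G}) z :
  Z \subset Y -> z \in L ->
  inner_cut U (component Z z) \subset (Y :\: Z) :|: (inner_cut U L :&: cut (component Z z)).
Proof.
move=> sZ zL; set S := component Z z.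
have SL : S \subset L.
  exact: component_inside (subset_trans sZ (subsetIr _ _)) zL.
apply/subsetP => e eD; have := eD; rewrite /inner_cut in_setI in_setI => /andP [/andP [eF eS] eU].
rewrite in_setU in_setD in_setI eS andbT.
have [eL|eL] := boolP (e \in inside L).
  rewrite [e \in Y]in_setI eF eL andbT.
  by case eZ: (e \in Z) => //=; move: eS; rewrite inE (component_ends _ eZ) addbb.
by apply/orP; right; rewrite !in_setI eF eU (cut_sub SL eS eL).
Qed.

(** The edges of F that leave a component inside L also leave L, so a proper component would have at
    most one inner edge, against [minL]. *)
Lemma minimal_connected z1 z2 : z1 \in L -> z2 \in L -> connect (adj Y) z1 z2.
Proof.
move=> h1 h2; apply: contraT => nc; set S := component Y z1.
have SL : S \subset L by exact: component_inside (subsetIr _ _) h1.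
have S0 : S != set0 by apply/set0Pn; exists z1; rewrite inE connect0.
have SnL : S != L by apply: contraNneq nc => SE; move: h2; rewrite -SE inE.
have := minL SL S0 SnL; rewrite ltnNge.
rewrite (leq_trans _ L1) //; apply: subset_leq_card.
apply: subset_trans (component_step_cut (subxx Y) h1) _.
by rewrite setDv set0U subsetIl.
Qed.

(** If f were a bridge, the components S and S' at its ends would each need a second inner edge,
    which must leave L. There is only one such edge, and it has only one end in L. *)
Lemma minimal_bridgeless : bridgeless Y.
Proof.
move=> f fY; have [fF] := setIP fY; rewrite inE => /andP [f1 f2].
pose Z := Y :\ f; set z := (ends f).1 in f1; set z' := (ends f).2 in f2.
suff /connect_join [P sP jP] : connect (adj Z) z z'.
  exists (f |: P); split; last exact: setU11.
    rewrite setUC -symd_disjoint.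
      exact: even_joins jP (join1 f).
    by rewrite disjoint_sym disjoints1; apply/negP => /(subsetP sP); rewrite !inE eqxx.
  by rewrite subUset sub1set fY (subset_trans sP) // subD1set.
apply: contraT => nc; set S := component Z z; set S' := component Z z'.
have sZ : Z \subset Y := subD1set _ _.
have ZL := subset_trans sZ (subsetIr _ _).
have SL : S \subset L by exact: component_inside ZL f1.
have SL' : S' \subset L by exact: component_inside ZL f2.
have zS : z \in S by rewrite inE connect0.
have zS' : z' \in S' by rewrite inE connect0.
have dSS v : v \in S -> v \in S' -> False.
  rewrite !inE => c1; rewrite (conn_sym Z) => c2; case/negP: nc; exact: connect_trans c1 c2.
have S0 : S != set0 by apply/set0Pn; exists z.
have S0' : S' != set0 by apply/set0Pn; exists z'.
have SnL : S != L by apply/eqP => SE; apply: (dSS z' _ zS'); rewrite SE.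
have SnL' : S' != L by apply/eqP => SE; apply: (dSS z zS); rewrite SE.
have YZ : Y :\: Z = [set f].
  by apply/setP => e; rewrite !inE -!/(_ \in Y); case: (e =P f) => [->|_] /=; rewrite ?(andbN, fY) ?andNb //; move: fY; rewrite !inE => ->.
have bound R : (inner_cut U R \subset (Y :\: Z) :|: (inner_cut U L :&: cut R)) ->
    1 < #|inner_cut U R| -> inner_cut U L :&: cut R != set0.
  move=> sR c; apply/eqP => e0; move: (subset_leq_card sR).
  by rewrite YZ e0 setU0 cards1 leqNgt c.
have /set0Pn [g /setIP [gL gS]] := bound _ (component_step_cut sZ f1) (minL SL S0 SnL).
have /set0Pn [g' /setIP [gL' gS']] := bound _ (component_step_cut sZ f2) (minL SL' S0' SnL').
have gg : g' = g by exact: (card_le1_eqP L1 _ _ gL gL').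
subst g'; have gcut : g \in cut L by move: gL; rewrite /inner_cut !in_setI => /andP [/andP []].
have dS : [disjoint S & S'].
  by apply/pred0P => v /=; apply/negP => /andP [h1 h2]; exact: dSS h1 h2.
by have := cut_disjoint SL SL' dS gcut gS; rewrite gS'.
Qed.

(** L is connected and bridgeless, so a closed trail passes through the ends in L of two edges to U;
    these two edges form T. *)
Lemma flow_step_large : 1 < #|outer_cut U L| ->
  exists2 X : {set vertex G}, X != set0 /\ [disjoint X & U] & (flow_outside (U :|: X) -> flow_outside U).
Proof.
case/card_gt1P => e1 [e2 [e1K e2K e12]].
have [x1 [u1 [x1L u1U j1 e1F]]] := outer_cutP dLU e1K.
have [x2 [u2 [x2L u2U j2 e2F]]] := outer_cutP dLU e2K.
have [C [CY evC cx Cc]] := closed_trail minimal_bridgeless (minimal_connected x1L x2L).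
have CF := subset_trans CY (subsetIl _ _).
pose X := component C x1.
have XL : X \subset L by exact: component_inside (subset_trans CY (subsetIr _ _)) x1L.
have x1X : x1 \in X by rewrite inE connect0.
have x2X : x2 \in X by rewrite inE.
have dXU : [disjoint X & U] by exact: disjointWl XL dLU.
have XU v : v \in X -> v \notin U by move=> vX; apply: notU; exact: (subsetP XL).
have UX v : v \in U -> v \notin X by apply: contraTN => /XU.
exists X; first by split => //; apply/set0Pn; exists x1.
case=> A [B1 [B2 [[AF B1F B2F] evA avA evB cov]]].
have CX : C \subset inside X.
  by apply/subsetP => e eC; have h := Cc _ eC; rewrite inE h -(component_ends _ eC).
pose U' := U :|: X; pose new := F :&: (inside U' :\: inside U).
pose T := [set e1; e2].
have eT e : e \in T -> [/\ e \in new, e \notin C & e \in cut X].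
  have aux f x u : x \in X -> u \in U -> joins f x u -> f \in F -> [/\ f \in new, f \notin C & f \in cut X].
    move=> xX uU j fF; rewrite in_setI fF in_setD (joins_notin_inside j (XU _ xX)) (joins_inside j xX uU).
    rewrite (joins_cut j xX (UX _ uU)); split => //; apply/negP => /(subsetP CX); apply/negP.
    apply: (joins_notin_inside (x := u) (u := x)); last exact: UX.
    by move: j; rewrite /joins orbC.
  by rewrite in_set2 => /orP [/eqP ->|/eqP ->]; [exact: aux j1 e1F | exact: aux j2 e2F].
pose V1 := (B1 :\: inside U') :|: (new :\: (C :|: T)).
pose V2 := (B2 :\: inside U').
pose q1 := odd #|V1 :&: cut X|; pose q2 := odd #|V2 :&: cut X|.
(* Two edges serve every pair of parities: in all four cases T1 and T2 cover T and have sizes of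
   parity q1 and q2. *)
pose T1 := if q1 then [set e1] else T.
pose T2 := if q2 then (if q1 then [set e2] else [set e1]) else (if q1 then T else set0).
have sT1 : T1 \subset T by rewrite /T1 /T; case: ifP => _; rewrite ?subxx ?sub1set ?set21.
have sT2 : T2 \subset T.
  by rewrite /T2 /T; do ?case: ifP => _; rewrite ?subxx ?sub1set ?set21 ?set22 ?sub0set.
have sT1' : [set e1] \subset T by rewrite sub1set set21.
have newU' : new \subset inside U' by apply/subsetP => e; rewrite !in_setI in_setD => /and3P [].
have dT e : e \in T -> e \notin V1 /\ e \notin V2.
  move=> h; have [eN _ _] := eT _ h; have eU' := subsetP newU' _ eN.
  split; last by rewrite in_setD eU'.
  by rewrite in_setU negb_or in_setD eU' in_setD in_setU h orbT.
have cT : #|T| = 2 by rewrite cards2 e12.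
have close (V T' : {set edge G}) : T' \subset T -> (forall e, e \in T -> e \notin V) ->
    odd #|T'| = odd #|V :&: cut X| -> odd #|[set v in X | par (V :|: T') v]| = false.
  move=> sT' nV o; rewrite odd_set_par setIUl cardsU.
  have -> : T' :&: cut X = T'.
    by apply/setIidPl/subsetP => e /(subsetP sT') /eT [].
  have -> : V :&: cut X :&: T' = set0.
    by apply/setP => e; rewrite !in_setI in_set0; case eT': (e \in T'); rewrite ?andbF // (negbTE (nV _ (subsetP sT' _ eT'))).
  by rewrite cards0 subn0 oddD o addbb.
apply: (@flow_lift U X x1 C A B1 B2 T T1 T2) => //.
- apply/subsetP => e /eT [h1 h2 _]; by rewrite in_setD h2.
- rewrite /T1 /T2; do ?case: ifP => _; rewrite ?setUid ?setU0 //; last exact/setUidPl/sT1'.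
  exact/setUidPr/sT1'.
- apply: close => //; first by move=> e /dT [].
  by rewrite /T1 /q1 /V1; case: ifP => _; rewrite ?cT ?cards1.
- apply: close => //; first by move=> e /dT [].
  by rewrite /T2 /q2 /V2; case: ifP => _; case: ifP => _; rewrite ?cT ?cards1 ?cards0.
Qed.

End Step.

(** A minimal L is a leaf or an isolated node in the forest of 2-edge-connected components of F
    outside U. *)
Lemma flow_step U : U != setT ->
  exists2 X : {set vertex G}, X != set0 /\ [disjoint X & U] & (flow_outside (U :|: X) -> flow_outside U).
Proof.
move=> UT.
pose good (L : {set vertex G}) := [&& L != set0, [disjoint L & U] & #|inner_cut U L| <= 1].
have gU : good (~: U).
  apply/and3P; split.
  - by apply: contraNneq UT => h; rewrite -(setCK U) h setC0.
  - by rewrite -setI_eq0 setIC setICr.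
  - rewrite (_ : inner_cut _ _ = set0) ?cards0 //; apply/setP => e.
    by rewrite !inE; case: (_ \in U); case: (_ \in U); rewrite ?andbF.
have [L /minsetP [/and3P [L0 dLU L1] minL] _] := minset_exists gU.
have mn S : S \subset L -> S != set0 -> S != L -> 1 < #|inner_cut U S|.
  move=> SL S0 SnL; rewrite ltnNge; apply: contra SnL => c.
  by apply/eqP/minL => //; rewrite /good S0 c (disjointWl SL dLU).
have [K|K] := leqP #|outer_cut U L| 1; first exact: flow_step_small K.
exact: flow_step_large mn K.
Qed.

(* Jaeger's eight-flow theorem, by Seymour's argument for the six-flow theorem. *)
Theorem eight_flow : exists A B1 B2 : {set edge G},
  [/\ even_set A, even_set B1, even_set B2 & F = A :|: (B1 :|: B2)].
Proof.
suff [A [B1 [B2 [[AF B1F B2F] evA _ evB cov]]]] : flow_outside set0.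
  exists A, B1, B2; split => //; try by apply/even_setP => v; have [] := evB v; rewrite ?inE.
  apply/eqP; rewrite eqEsubset !subUset AF B1F B2F !andbT; apply: subset_trans cov.
  by apply/subsetP => e eF; rewrite in_setD eF inE inE.
have [n] := ubnP #|~: (set0 : {set vertex G})|.
elim: n set0 => // n IH U Un.
have [->|UT] := eqVneq U setT.
  exists set0, set0, set0; rewrite !sub0set even_set0; split => //.
    by move=> v; rewrite inE.
  by apply/subsetP => e; rewrite !inE.
have [X [X0 dXU] lift] := flow_step UT; apply: lift; apply: IH.
rewrite ltnS in Un; apply: leq_trans Un; apply: proper_card.
rewrite properEneq setCS subsetUl andbT; apply: contra X0 => /eqP h.
have {}h : U :|: X = U by rewrite -[LHS]setCK h setCK.
apply/eqP/setP => v; rewrite inE; apply/negP => vX.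
have : v \in U by rewrite -h inE vX orbT.
by move: dXU => /pred0P /(_ v) /=; rewrite vX /= => ->.
Qed.

End EightFlow.

(** * Barbells *)

Section Walks.
Variable G : mgraph.
Implicit Types (Q : {set edge G}) (S T : {set vertex G}) (p : seq (edge G * vertex G)).
Implicit Types (u v w : vertex G) (e : edge G).

Lemma walk_edges_cons e w p : walk_edges ((e, w) :: p) = e |: walk_edges p.
Proof. by apply/setP => f; rewrite !inE. Qed.

Lemma walk_edges_ends u p e v : is_walk u p -> e \in walk_edges p -> incident e v ->
  v \in walk_vertices u p.
Proof.
elim: p u => [|[f w] p IH] u /=; first by rewrite inE.
case/andP => j wp; rewrite walk_edges_cons inE in_set1 => /orP [/eqP ->|ep] inc.
  by case/orP: j inc => /eqP fe; rewrite /incident fe /= => /orP [/eqP <-|/eqP <-];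
    rewrite !inE eqxx ?orbT.
by rewrite inE (IH _ wp ep inc) orbT.
Qed.

Lemma path_walk Q u s : path (adj Q) u s ->
  exists p, [/\ is_walk u p, [seq x.2 | x <- p] = s & walk_edges p \subset Q].
Proof.
elim: s u => [|w s IH] u /=.
  by exists [::]; split => //; apply/subsetP => e; rewrite inE.
case/andP => /existsP [e /andP [eQ j]] /IH [p [wp <- sp]].
exists ((e, w) :: p); split => //=; first by rewrite j.
by rewrite walk_edges_cons subUset sub1set eQ.
Qed.

Lemma walk_join u p : is_walk u p -> uniq (walk_vertices u p) ->
  join (walk_edges p) u (last u [seq x.2 | x <- p]).
Proof.
elim: p u => [|[e w] p IH] u /=.
  move=> _ _; rewrite (_ : walk_edges [::] = set0); first exact: even_join (even_set0 _).
  by apply/setP => e; rewrite !inE.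
case/andP => j wp /andP [un un'].
have ne : e \notin walk_edges p.
  apply: contra un => ep; apply: (walk_edges_ends wp ep).
  by rewrite /incident; case/orP: j => /eqP -> /=; rewrite eqxx ?orbT.
rewrite walk_edges_cons -symd_disjoint ?disjoints1 //.
exact: join_trans (joins_join j) (IH _ wp un').
Qed.

Lemma connect_walk Q u v : connect (adj Q) u v ->
  exists2 p, is_path u v p & walk_edges p \subset Q.
Proof.
case/connectP => s ps ->; case: (shortenP ps) => s' ps' us' _.
have [p [wp sE sp]] := path_walk ps'; exists p => //; split => //; rewrite ?sE //.
by rewrite /walk_vertices sE.
Qed.

(** Keeps the path from its last visit to S onwards. *)
Lemma trim_head S u p : is_walk u p -> uniq (walk_vertices u p) ->
  has (mem S) (walk_vertices u p) ->
  exists u' p', [/\ u' \in S, is_path u' (last u [seq x.2 | x <- p]) p',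
    walk_edges p' \subset walk_edges p & ~~ has (mem S) [seq x.2 | x <- p']].
Proof.
elim: p u => [|[e w] p IH] u.
  by rewrite /= orbF => _ _ uS; exists u, [::].
move=> wp up hp; move: (wp) (up) => /= /andP [j wp'] /andP [_ up'].
have [hS|nS] := boolP (has (mem S) (walk_vertices w p)).
  have [u' [p' [h1 h2 h3 h4]]] := IH w wp' up' hS.
  exists u', p'; split => //; rewrite walk_edges_cons; exact: subset_trans h3 (subsetUr _ _).
exists u, ((e, w) :: p); split => //.
by move: hp; rewrite /= => /orP [] //; move: nS; rewrite /= => /negbTE ->.
Qed.

(** Stops the path at its first visit to S. *)
Lemma trim_last S u p : is_walk u p -> uniq (walk_vertices u p) ->
  has (mem S) (walk_vertices u p) ->
  exists v p', [/\ is_path u v p', walk_edges p' \subset walk_edges p,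
    {subset [seq x.2 | x <- p'] <= [seq x.2 | x <- p]} &
    S :&: [set x in walk_vertices u p'] = [set v]].
Proof.
have one u' : u' \in S -> S :&: [set x in walk_vertices u' [::]] = [set u'].
  by move=> uS; apply/setP => v; rewrite !inE; case: eqP => [->|]; rewrite ?uS ?andbF.
elim: p u => [|[e w] p IH] u.
  by rewrite /= orbF => _ _ uS; exists u, [::]; split => //; exact: one.
have [uS _ _ _|uS] := boolP (u \in S).
  exists u, [::]; split => //; last exact: one.
  by apply/subsetP => f; rewrite inE.
move=> /= /andP [j wp] /andP [un up]; rewrite (negbTE uS) /= => hp.
have [v [p' [[q1 q2 q3] h2 h3 h4]]] := IH w wp up hp.
exists v, ((e, w) :: p'); split.
- split => //=; first by rewrite j.
  rewrite -/(walk_vertices w p') -[_ && uniq _]/(uniq (walk_vertices w p')) q2 andbT; apply: contra un; rewrite !inE => /orP [->//|h].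
  by rewrite h3 ?orbT.
- by rewrite !walk_edges_cons setUS.
- by move=> x; rewrite /= !inE => /orP [->//|/h3 ->]; rewrite orbT.
- rewrite -h4; apply/setP => x; rewrite !inE; case: (x =P u) => [->|] //=.
  by rewrite (negbTE uS).
Qed.

Lemma trim_path S T u v p : [disjoint S & T] -> u \in S -> v \in T -> is_path u v p ->
  exists u' v' p', [/\ is_path u' v' p', walk_edges p' \subset walk_edges p,
    S :&: [set x in walk_vertices u' p'] = [set u'] &
    T :&: [set x in walk_vertices u' p'] = [set v']].
Proof.
move=> d uS vT [wp up lp].
have [u' [p1 [u'S [w1 un1 l1] s1 n1]]] : exists u' p', [/\ u' \in S, is_path u' (last u [seq x.2 | x <- p]) p',
    walk_edges p' \subset walk_edges p & ~~ has (mem S) [seq x.2 | x <- p']].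
  by apply: trim_head => //=; rewrite uS.
have [v' [p2 [[w2 un2 l2] s2 sub2 E2]]] : exists v p', [/\ is_path u' v p', walk_edges p' \subset walk_edges p1,
    {subset [seq x.2 | x <- p'] <= [seq x.2 | x <- p1]} &
    T :&: [set x in walk_vertices u' p'] = [set v]].
  apply: trim_last => //; apply/hasP; exists (last u' [seq x.2 | x <- p1]); first exact: mem_last.
  by rewrite l1 lp.
exists u', v', p2; split => //; first exact: subset_trans s2 s1.
apply/setP => x; rewrite !inE; case: (x =P u') => [->|_] /=; first by rewrite u'S.
apply/negP => /andP [xS /sub2 xp]; case/negP: n1; apply/hasP; by exists x.
Qed.

Variable sigma : signature G.

Lemma path_barbell C1 C2 v1 v2 p :
  negative_cycle sigma C1 -> negative_cycle sigma C2 ->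
  [disjoint vertices_of C1 & vertices_of C2] -> v1 \in vertices_of C1 -> v2 \in vertices_of C2 ->
  is_path v1 v2 p ->
  exists2 B : {set edge G}, barbell sigma B &
    C1 :|: C2 \subset B /\ B \subset C1 :|: C2 :|: walk_edges p.
Proof.
move=> n1 n2 d h1 h2 hp.
have [u [v [q [hq sq E1 E2]]]] := trim_path d h1 h2 hp.
exists (C1 :|: C2 :|: walk_edges q); last by rewrite subsetUl setUS.
have d0 : vertices_of C1 :&: vertices_of C2 = set0 by apply/eqP; rewrite setI_eq0.
exists C1, C2, u, v, q; split => //.
  apply/pred0P => e /=; apply/negP => /andP [e1 e2].
  move/setP: d0 => /(_ (ends e).1); rewrite !inE => /negP []; apply/andP.
  by split; apply/existsP; exists e; rewrite ?e1 ?e2 eqxx.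
by split; rewrite setIUr ?E1 ?E2 ?d0 ?setU0 // setIC d0 setU0.
Qed.

(** A path in Q from t to another vertex t' of W gives a barbell; without its edges Q joins the
    remaining vertices, so each edge of Q is spent at most once. Crossing other cycles on the way is
    harmless, as a barbell only restricts the path at its own two cycles. *)
Lemma barbell_cover (c : vertex G -> {set edge G}) (W : {set vertex G}) Q :
  (forall t, t \in W -> negative_cycle sigma (c t) /\ t \in vertices_of (c t)) ->
  {in W &, forall t t', t != t' -> [disjoint vertices_of (c t) & vertices_of (c t')]} ->
  (forall v, par Q v = (v \in W)) ->
  exists s : seq {set edge G}, [/\ forall C, C \in s -> barbell sigma C,
    forall t e, t \in W -> e \in c t -> exists2 C, C \in s & e \in C &
    cover_length s <= \sum_(t in W) #|c t| + #|Q|].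
Proof.
have [n] := ubnP #|W|; elim: n W Q => // n IH W Q Wn hW dW pQ.
have [W0|[t tW]] := set_0Vmem W.
  exists [::]; split => //; first by move=> t e; rewrite W0 inE.
  by rewrite /cover_length big_nil.
have /odd_pair [t' [tt]] : par Q t by rewrite pQ.
rewrite pQ => t'W /connect_walk [p pp sp].
have [wp up lp] := pp; have jp := walk_join wp up; rewrite lp in jp.
pose W' := W :\ t :\ t'; pose Q' := Q :\: walk_edges p.
have t'W1 : t' \in W :\ t by rewrite !inE tt.
have cW := cardsD1 t W; have cW' := cardsD1 t' (W :\ t).
rewrite tW in cW; rewrite t'W1 in cW'.
have sW : W' \subset W by apply: subset_trans (subD1set _ _) (subD1set _ _).
have [||||s [bs cs ls]] := IH W' Q'.
- by rewrite /W'; move: Wn cW cW'; clear; lia.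
- by move=> x /(subsetP sW) /hW.
- by move=> x y /(subsetP sW) xW /(subsetP sW); exact: dW.
- move=> v; rewrite par_setD // pQ jp !inE.
  have [->|_] := eqVneq v t; first by rewrite ?eqxx tW [t == t']eq_sym (negbTE tt).
  have [->|_] := eqVneq v t'; first by rewrite ?eqxx t'W ?(negbTE tt).
  by rewrite ?addbF.
have [nt vt] := hW _ tW; have [nt' vt'] := hW _ t'W.
rewrite eq_sym in tt.
have [B bB [sB Bs]] := path_barbell nt nt' (dW _ _ tW t'W tt) vt vt' pp.
exists (B :: s); split.
- by move=> C; rewrite inE => /orP [/eqP ->|/bs].
- move=> x e xW ex.
  have [xt|xt] := eqVneq x t; first by exists B; rewrite ?mem_head // (subsetP sB) // inE -xt ex.
  have [xt'|xt'] := eqVneq x t'; first by exists B; rewrite ?mem_head // (subsetP sB) // inE -xt' ex orbT.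
  by have [|C Cs eC] := cs x e _ ex; [rewrite !inE xt xt' | exists C; rewrite ?inE ?Cs ?orbT].
rewrite /cover_length big_cons (big_setD1 t tW) /= (big_setD1 t' t'W1) /=.
have := subset_leq_card Bs; have := leq_of_leqif (leq_card_setU (c t :|: c t') (walk_edges p)).
have := leq_of_leqif (leq_card_setU (c t) (c t')); have := cardsID (walk_edges p) Q; rewrite (setIidPr sp).
move: ls; rewrite /cover_length -/W' -/Q'.
move: (\sum_(C <- s) _) (\sum_(i in W') _) #|Q'| #|Q| #|B| #|walk_edges p| #|c t| #|c t'|.
move: (#|_ :|: _|) (#|_ :|: _|); clear.
move=> *; lia.
Qed.

End Walks.

(** * Cycles and covers by even sets *)

Section Components.
Variable G : mgraph.
Implicit Types (X R C S : {set edge G}) (u v : vertex G) (e : edge G).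

Lemma degree_gt0 C v : v \in vertices_of C -> 0 < degree C v.
Proof.
rewrite inE => /existsP [e /andP [eC inc]]; rewrite /degree (bigD1 e) //=.
by case/orP: inc => ->; rewrite ?addn1 ?addnS //= addSn.
Qed.

Lemma degree_le C v : degree C v <= degree setT v.
Proof.
by rewrite /degree big_mkcond [leqRHS]big_mkcond; apply: leq_sum => e _; rewrite inE; case: ifP.
Qed.

Lemma cycle_even C : is_cycle C -> even_set C.
Proof.
case=> _ d _; apply/even_setP => v; rewrite -odd_degree.
have [/d -> //|nv] := boolP (v \in vertices_of C).
rewrite /degree big1 // => e eC; apply/eqP; rewrite addn_eq0 !eqb0.
move: nv; rewrite inE => /existsPn /(_ e); rewrite eC /= negb_or.
by case/andP => -> ->.
Qed.

Lemma vertices_component X u : {subset vertices_of (component_edges X u) <= component X u}.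
Proof.
move=> v; rewrite inE => /existsP [e /andP []]; rewrite inE => /andP [eX h] inc.
have h2 := h; rewrite (component_ends _ eX) in h2.
by case/orP: inc => /eqP <-.
Qed.

Lemma component_root_vertex X u e : e \in component_edges X u -> u \in vertices_of (component_edges X u).
Proof.
move=> eC; have := eC; rewrite inE => /andP [eX]; rewrite inE => /connectP [p].
case: p => [_ h|w p /= /andP [/existsP [f /andP [fX j]] _] _].
  by rewrite inE; apply/existsP; exists e; rewrite eC h eqxx.
have inc : incident f u by rewrite /incident; case/orP: j => /eqP -> /=; rewrite eqxx ?orbT.
rewrite inE; apply/existsP; exists f; apply/andP; split => //.
by rewrite (component_edges_incident _ inc) // inE connect0.
Qed.

(** At a vertex that the component meets, the degree is even, positive and at most 3. *)
Lemma component_cycle X u e : cubic G -> even_set X -> e \in component_edges X u ->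
  is_cycle (component_edges X u).
Proof.
move=> cub /even_setP ev eC; split; first by apply/set0Pn; exists e.
  move=> v vC; have := degree_gt0 vC; have := degree_le (component_edges X u) v.
  rewrite (cub v); have := odd_degree (component_edges X u) v; rewrite component_edges_par ev andbF.
  by case: (degree _ v) => [|[|[|[|]]]].
move=> v w /vertices_component hv /vertices_component hw.
apply: connect_trans (component_edges_connect hw).
rewrite (conn_sym (component_edges X u)); exact: component_edges_connect.
Qed.

(** One canonical vertex for each component, so that sums over components are sums over vertices. *)
Definition is_root X u := fingraph.root (adj X) u == u.

Lemma root_component X u v : is_root X u -> (v \in component X u) = (fingraph.root (adj X) v == u).
Proof.
by move=> /eqP ru; rewrite inE -{2}ru eq_sym (root_connect (conn_sym X)).
Qed.

Lemma card_by_component X R :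
  #|X :&: R| = \sum_(u | is_root X u) #|component_edges X u :&: R|.
Proof.
rewrite -sum1_card (partition_big (fun e => fingraph.root (adj X) (ends e).1) (is_root X)) /=; last first.
  by move=> e _; apply/eqP; apply: root_root; exact: conn_sym.
apply: eq_bigr => u ru; rewrite -sum1_card; apply: eq_bigl => e.
rewrite !inE -root_component // inE.
by case: (e \in X); case: (e \in R); rewrite ?andbF ?andbT.
Qed.

Lemma root_exists X e : e \in X -> exists2 u, is_root X u & e \in component_edges X u.
Proof.
move=> eX; exists (fingraph.root (adj X) (ends e).1).
  by apply/eqP; apply: root_root; exact: conn_sym.
rewrite inE eX /= inE (conn_sym X); exact: connect_root.
Qed.

Lemma root_vertices_disjoint X u v : is_root X u -> is_root X v -> u != v ->
  [disjoint vertices_of (component_edges X u) & vertices_of (component_edges X v)].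
Proof.
move=> ru rv uv; apply/pred0P => w /=; apply/negP => /andP [/vertices_component h1 /vertices_component h2].
by move: h1 h2 uv; rewrite !root_component // => /eqP -> /eqP ->; rewrite eqxx.
Qed.

Lemma components_seq X (P : pred (vertex G)) : exists s : seq {set edge G},
  [/\ forall C, C \in s -> exists u e, [/\ P u, is_root X u, C = component_edges X u & e \in C],
    forall u e, P u -> is_root X u -> e \in component_edges X u -> component_edges X u \in s &
    cover_length s <= \sum_(u | is_root X u && P u) #|component_edges X u|].
Proof.
pose Q u := [&& is_root X u, P u & component_edges X u != set0].
exists [seq component_edges X u | u <- enum Q]; split.
- move=> C /mapP [u]; rewrite mem_enum => /and3P [ru pu /set0Pn [e eC]] ->.
  by exists u, e.
- move=> u e pu ru eC; apply: map_f; rewrite mem_enum; apply/and3P; split => //.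
  by apply/set0Pn; exists e.
rewrite /cover_length big_map big_enum /= [leqRHS](bigID (fun u => component_edges X u != set0)) /=.
apply: leq_trans (leq_addr _ _); apply: eq_leq; apply: eq_bigl => u.
by rewrite /in_mem /= /Q andbA.
Qed.

Lemma even_cycle_cover X : cubic G -> even_set X -> exists s : seq {set edge G},
  [/\ forall C, C \in s -> is_cycle C /\ C \subset X,
    forall e, e \in X -> exists2 C, C \in s & e \in C & cover_length s <= #|X|].
Proof.
move=> cub ev; have [s [h1 h2 h3]] := components_seq X predT; exists s; split.
- move=> C /h1 [u [e [_ _ -> eC]]]; split; last exact: component_edges_sub.
  exact: component_cycle eC.
- move=> e /root_exists [u ru eC]; exists (component_edges X u) => //; exact: h2 eC.
rewrite -[X in _ <= #|pred_of_set X|]setIT card_by_component; apply: leq_trans h3 _.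
by apply: eq_leq; apply: eq_big => u; rewrite ?andbT // setIT.
Qed.

Lemma even_odd_vertices X : ~~ odd #|[set v | par X v]|.
Proof.
have := odd_set_par X setT; rewrite (_ : X :&: cut setT = set0); last first.
  by apply/setP => e; rewrite !inE andbF.
by rewrite cards0 /= => h; apply: contraFN h; apply: eq_ind; congr (odd #|pred_of_set _|); apply/setP => v; rewrite !inE.
Qed.

Lemma cut_disconnects S : 0 < #|vertex G| -> ~~ spanning_connected (~: S) ->
  exists A : {set vertex G}, cut A \subset S /\ ~~ spanning_connected (~: cut A).
Proof.
move=> V0; rewrite /spanning_connected V0 /= => /forallPn [u /forallPn [v nc]].
exists (component (~: S) u); split.
  apply/subsetP => e; rewrite inE; apply: contraLR => eS.
  by rewrite (component_ends _ (_ : e \in ~: S)) ?addbb // inE.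
apply/forallPn; exists u; apply/forallPn; exists v; apply: contra nc => /connectP [p].
elim/last_ind: p v => [|p w IH] v /=; first by move=> _ ->; exact: connect0.
rewrite rcons_path last_rcons => /andP [pth /existsP [e /andP [eC j]]] ->.
have := IH _ pth erefl; move: eC; rewrite !inE.
by case/orP: j => /eqP -> /=; rewrite ?inE => h1 h2; move: h1; rewrite h2 /= ?addbT negbK.
Qed.

(** A minimal disconnecting set equals the cut of a vertex set. *)
Lemma edge_cut_even S X : 0 < #|vertex G| -> edge_cut S -> even_set X -> odd #|X :&: S| = false.
Proof.
move=> V0 /minsetP [nc mn] ev; have [A [sA nA]] := cut_disconnects V0 nc.
by rewrite -(mn _ nA sA) even_cut.
Qed.

End Components.

(** Classical, because being a circuit cover is a proposition without a decision procedure here; it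
    supplies the minimum in [is_scc]. *)
Lemma ex_minimum (P : nat -> Prop) : (exists n, P n) -> exists2 n, P n & forall k, P k -> n <= k.
Proof.
case=> n; have [k] := ubnP n; elim: k n => // k IH n nk pn.
have [[j [jn pj]]|none] := classic (exists j, j < n /\ P j).
  by apply: IH pj; exact: leq_trans jn nk.
by exists n => // j pj; rewrite leqNgt; apply/negP => jn; apply: none; exists j.
Qed.

(** * Choosing three even sets by averaging over F_8 *)

Section Fano.
Variable G : mgraph.
Variables A B C : {set edge G}.

(* The nonzero elements 1, x, x^2, ..., x^6 of F_8 (with x^3 = x + 1), where 1, x, x^2 stand
   for A, B, C: any three cyclically consecutive ones form a basis over F_2. *)
Definition fano : seq {set edge G} :=
  [:: A; B; C; symd A B; symd B C; symd (symd A B) C; symd A C].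

(** Memberships in A, B, C give each edge of R a nonzero vector of F_2^3, and four of the seven
    nonzero linear forms take the value 1 on it. *)
Lemma fano_card (R : {set edge G}) : R \subset A :|: (B :|: C) ->
  \sum_(X <- fano) #|X :&: R| = 4 * #|R|.
Proof.
move=> /subsetP sR.
have h (X : {set edge G}) : #|X :&: R| = \sum_(e in R) (e \in X).
  rewrite -sum1_card [RHS]big_mkcond [LHS]big_mkcond; apply: eq_bigr => e _.
  by rewrite inE; case: (e \in X); case: (e \in R).
under eq_bigr => X _ do rewrite h.
rewrite exchange_big /= -sum1_card big_distrr /=; apply: eq_bigr => e /sR.
rewrite !big_cons big_nil !inE.
by case: (e \in A); case: (e \in B); case: (e \in C).
Qed.

Lemma fano_even X : even_set A -> even_set B -> even_set C -> X \in fano -> even_set X.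
Proof.
move=> eA eB eC; rewrite !inE.
by do 6 ?[case/orP => [/eqP ->|]; first by rewrite ?even_symd]; move=> /eqP ->; rewrite ?even_symd.
Qed.

Lemma fano_sub X F : A :|: (B :|: C) = F -> X \in fano -> X \subset F.
Proof.
move=> FE.
have [sA sB sC] : [/\ A \subset F, B \subset F & C \subset F].
  by rewrite -FE; split; apply/subsetP => e; rewrite !inE => ->; rewrite ?orbT.
rewrite !inE.
by do 6 ?[case/orP => [/eqP ->|]; first by rewrite ?symd_subset]; move=> /eqP ->; rewrite ?symd_subset.
Qed.

(** Averaging over the seven cyclic triples: each set is in three of them, so their sizes sum to 3 *
    4|F|, and some triple has at most 12/7 |F|. A basis of linear forms does not vanish on a nonzero
    vector, hence each triple covers F. *)
Lemma fano_basis F : A :|: (B :|: C) = F -> exists X Y Z,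
  [/\ [/\ X \in fano, Y \in fano & Z \in fano], F \subset X :|: (Y :|: Z) &
      7 * (#|X| + #|Y| + #|Z|) <= 12 * #|F|].
Proof.
move=> FE; have := @fano_card F; rewrite FE subxx => /(_ isT).
have eqI (X : {set edge G}) : X \in fano -> #|X :&: F| = #|X| by move=> h; rewrite (setIidPl (fano_sub FE h)).
rewrite (eq_big_seq (fun X : {set edge G} => #|X|)) => [|X /eqI //].
rewrite /fano !big_cons big_nil addn0.
pose f i := nth set0 fano (i %% 7).
have ff i : f i \in fano by apply: mem_nth; exact: ltn_pmod.
pose small i := 7 * (#|f i| + #|f i.+1| + #|f i.+2|) <= 12 * #|F|.
move=> sum; have /hasP [i i7 si] : has small (iota 0 7).
  apply/negPn/negP; rewrite /= /small /f /=; move: sum.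
  move: #|A| #|B| #|C| #|symd A B| #|symd B C| #|symd (symd A B) C| #|symd A C| #|F|; clear; lia.
exists (f i), (f i.+1), (f i.+2); split => //.
move: i7 {si}; rewrite mem_iota add0n => /andP [_ i7]; apply/subsetP => e; rewrite -FE /f; move: i7.
do 7 ?[case: i => [_|i] /=; first by rewrite !inE; case: (e \in A); case: (e \in B); case: (e \in C)].
by [].
Qed.

End Fano.

(** * The signed circuit cover *)

Section CubicSignedGraph.
Variable G : mgraph.
Hypothesis connG : two_edge_connected G.
Hypothesis cubicG : cubic G.
Implicit Types (X Z C S : {set edge G}) (e : edge G) (u v : vertex G).

Lemma vertex_gt0 : 0 < #|vertex G|.
Proof. by have := connG (S := set0); rewrite cards0 => /(_ isT) /andP []. Qed.

Lemma connect_delete S u v : #|S| < 2 -> connect (adj (~: S)) u v.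
Proof. by move=> /connG /andP [_ /forallP /(_ u) /forallP /(_ v)]. Qed.

Lemma bridgeless_setT : bridgeless [set: edge G].
Proof.
move=> e _.
have /connect_join [P sP jP] : connect (adj (~: [set e])) (ends e).1 (ends e).2.
  by apply: connect_delete; rewrite cards1.
exists (symd P [set e]); split; [exact: even_joins jP (join1 e) | exact: subsetT |].
have eP : e \notin P by apply/negP => /(subsetP sP); rewrite !inE eqxx.
by rewrite !inE eqxx (negbTE eP).
Qed.

Lemma card_edge_vertex : #|edge G| * 2 = #|vertex G| * 3.
Proof.
transitivity (\sum_(v : vertex G) degree setT v); last first.
  by rewrite (eq_bigr (fun=> 3)) => [|v _]; rewrite ?sum_nat_const.
rewrite /degree exchange_big /= (eq_bigl predT) => [|e]; last by rewrite inE.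
rewrite (eq_bigr (fun=> 2)) ?sum_nat_const // => e _; rewrite big_split /=.
have h (a : vertex G) : \sum_v (a == v) = 1.
  by rewrite (bigD1 a) //= eqxx big1 // => v va; rewrite eq_sym (negbTE va).
by rewrite !h.
Qed.

Lemma short_join (W : {set vertex G}) : ~~ odd #|W| ->
  exists2 Q : {set edge G}, forall v, par Q v = (v \in W) & #|Q| * 2 <= #|vertex G|.
Proof.
move=> ev; have [r _] := card_gt0P vertex_gt0.
have [|Q0 _ pQ0] := @join_parity_set _ setT W r _ ev.
  by move=> v _; rewrite -setC0; apply: connect_delete; rewrite cards0.
pose P (Q : {set edge G}) := [forall v, par Q v == (v \in W)].
have PQ0 : P Q0 by apply/forallP => v; rewrite pQ0.
case: (arg_minnP (fun Q : {set edge G} => #|Q|) PQ0) => Q /forallP pQ mn.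
have {}pQ v : par Q v = (v \in W) by apply/eqP.
exists Q => //; apply: cubic_min_join_card => //; first exact: bridgeless_setT.
move=> X /even_setP ev'; apply: mn; apply/forallP => v.
by rewrite par_symd pQ ev' addbF.
Qed.

Section MinimumSignature.
Variable N : {set edge G}.
Hypothesis minN : forall S, edge_cut S -> #|S :&: N| * 2 <= #|S|.

(** A cut inside N would have at most half of its edges in N, and so be empty. *)
Lemma not_edge_cut_sub S : S \subset N -> spanning_connected (~: S).
Proof.
move=> sS; apply: contraT => nc; have [S' mS' sS'] := @minset_exists _ (fun S0 : {set edge G} => ~~ spanning_connected (~: S0)) _ nc.
have S'N : S' :&: N = S' by apply/setIidPl; exact: subset_trans sS' sS.
have := minN mS'; rewrite S'N => c; have c0 : #|S'| = 0 by move: c; clear; lia.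
have /minsetP [] := mS'; rewrite (cards0_eq c0) setC0 => /negP [].
by rewrite -setC0; apply: connG; rewrite cards0.
Qed.

Lemma even_superset_exists : exists2 Z : {set edge G}, even_set Z & N \subset Z.
Proof.
have [r _] := card_gt0P vertex_gt0.
have [|J sJ pJ] := @join_parity_set _ (~: N) [set v | par N v] r _ (even_odd_vertices N).
  move=> v _; have := not_edge_cut_sub (subxx N).
  by case/andP => _ /forallP /(_ r) /forallP /(_ v).
have dNJ : [disjoint N & J] by rewrite disjoint_sym disjoints_subset.
exists (N :|: J); last exact: subsetUl.
by apply/even_setP => v; rewrite par_setU // pJ inE addbb.
Qed.

Definition cyclic_edges : {set edge G} :=
  [set e in ~: N | [exists X : {set edge G}, [&& even_set X, X \subset ~: N & e \in X]]].

Lemma cyclic_edges_bridgeless : bridgeless cyclic_edges.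
Proof.
move=> e; rewrite inE => /andP [_ /existsP [X /and3P [ev sX eX]]].
exists X; split => //; apply/subsetP => f fX; rewrite inE (subsetP sX) //=.
by apply/existsP; exists X; rewrite ev sX.
Qed.

(** Such an e is a bridge of the graph of positive edges, so it is the only positive edge of some
    edge cut S. By [minN] at most half of S is in N, so S consists of e and one edge of N; Z meets S
    evenly and contains the latter. *)
Lemma bridge_in_even_superset Z e : even_set Z -> N \subset Z -> e \notin N ->
  e \notin cyclic_edges -> e \in Z.
Proof.
move=> evZ NZ eN eF.
have nc : ~~ spanning_connected (~: (e |: N)).
  apply: contra eF => /andP [_ /forallP /(_ (ends e).1) /forallP /(_ (ends e).2)].
  case/connect_join => P sP jP; rewrite inE in_setC eN /=; apply/existsP.
  have eP : e \notin P by apply/negP => /(subsetP sP); rewrite !inE eqxx.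
  exists (symd P [set e]); apply/and3P; split.
  - exact: even_joins jP (join1 e).
  - apply: symd_subset; last by rewrite sub1set inE.
    by apply: subset_trans sP _; rewrite setCS subsetUr.
  - by rewrite !inE eqxx (negbTE eP).
have [S mS sS] := @minset_exists _ (fun S0 : {set edge G} => ~~ spanning_connected (~: S0)) _ nc.
have eS : e \in S.
  apply: contraT => eS; have sSN : S \subset N.
    apply/subsetP => f fS; have := subsetP sS _ fS; rewrite in_setU1 => /orP [/eqP fe|//].
    by rewrite -fe fS in eS.
  by have /minsetP [/negP []] := mS; exact: not_edge_cut_sub.
have SE : S :\ e = S :&: N.
  apply/setP => f; rewrite in_setD1 in_setI.
  case fS: (f \in S); rewrite ?andbF // andbT.
  have := subsetP sS _ fS; rewrite in_setU1; case: (f =P e) => [->|_ /= -> //].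
  by rewrite (negbTE eN).
have cS := cardsD1 e S; rewrite eS SE in cS.
have S2 : 1 < #|S|.
  by rewrite ltnNge; apply/negP => c; have /minsetP [/negP []] := mS; exact: connG.
have c1 : #|S :&: N| = 1 by move: (minN mS) cS S2; clear; lia.
have := edge_cut_even vertex_gt0 mS evZ; apply: contraFT => eZ.
suff -> : Z :&: S = S :&: N by rewrite c1.
rewrite -SE; apply/setP => f; rewrite in_setI in_setD1.
case fS: (f \in S); rewrite ?andbF // !andbT.
case: (f =P e) => [->|fe]; first exact: negbTE.
apply: (subsetP NZ); have := subsetP sS _ fS; rewrite in_setU1; by case/orP => [/eqP|].
Qed.

(* 107/42 = 12/7 + 1/2 + 1/3: the cycles of three even sets covering the edges that are
   not bridges, half of these edges once more in the smallest even set containing N, and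
   the paths of the barbells. *)
Lemma signed_cover (sigma : signature G) :
  ~~ odd #|N| -> (forall X, even_set X -> odd #|X :&: negative_edges sigma| = odd #|X :&: N|) ->
  exists2 s : seq {set edge G}, circuit_cover sigma s & 42 * cover_length s <= 107 * #|edge G|.
Proof.
move=> oN sg.
pose F := cyclic_edges.
have FN : F \subset ~: N by apply/subsetP => e; rewrite inE => /andP [].
have [A [B [C [evA evB evC FE]]]] := eight_flow cyclic_edges_bridgeless.
have [X1 [X2 [X3 [[f1 f2 f3] cov c7]]]] := fano_basis (esym FE).
have fev X (h : X \in fano A B C) := fano_even evA evB evC h.
have fsub X (h : X \in fano A B C) := fano_sub (esym FE) h.
have [Z0 evZ0 NZ0] := even_superset_exists.
pose P Z := even_set Z && (N \subset Z).
have PZ0 : P Z0 by rewrite /P evZ0.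
case: (arg_minnP (fun Z : {set edge G} => #|Z|) PZ0) => Z /andP [evZ NZ] minZ.
(* Adding one of the seven even sets X to Z modulo 2 leaves N inside, so by minimality Z contains at
   most half of X. Each edge of F is in four of the seven, and summation gives the claim. *)
have half : 2 * #|Z :&: F| <= #|F|.
  have hX X : X \in fano A B C -> 2 * #|X :&: (Z :&: F)| <= #|X :&: F|.
    move=> hX; have XF := fsub _ hX; rewrite -/F in XF.
    rewrite (setIC Z) setIA !(setIidPl XF).
    have := card_symd Z X; rewrite setIC; suff : #|Z| <= #|symd Z X| by clear; lia.
    apply: minZ; apply/andP; split; first by apply: even_symd => //; exact: fev.
    apply/subsetP => e eN; rewrite inE (subsetP NZ) //=.
    by apply/negP => /(subsetP XF) /(subsetP FN); rewrite inE eN.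
  have := fano_card (A := A) (B := B) (C := C) (R := Z :&: F).
  rewrite -FE subsetIr => /(_ isT) e1.
  have := fano_card (A := A) (B := B) (C := C) (R := F); rewrite -FE subxx => /(_ isT) e2.
  have : 2 * (\sum_(X <- fano A B C) #|X :&: (Z :&: F)|) <= \sum_(X <- fano A B C) #|X :&: F|.
    by rewrite big_distrr /= big_seq [leqRHS]big_seq; apply: leq_sum => X; exact: hX.
  by rewrite e1 e2; clear; lia.
have cyc X e : X \in fano A B C -> X :&: N = set0.
  move=> /fsub XF; apply/setP => f; rewrite in_setI in_set0; apply/negP => /andP [fX fN].
  by have := subsetP FN _ (subsetP XF _ fX); rewrite inE fN.
have pos X : X \in fano A B C -> exists s : seq {set edge G},
   [/\ forall C', C' \in s -> circuit sigma C', forall e, e \in X -> exists2 C', C' \in s & e \in C' &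
       cover_length s <= #|X|].
  move=> hX; have [s [h1 h2 h3]] := even_cycle_cover cubicG (fev _ hX); exists s; split => //.
  move=> C' /h1 [cC sC]; left; split => //; rewrite sg ?cycle_even //.
  suff -> : C' :&: N = set0 by rewrite cards0.
  apply/eqP; rewrite -subset0; apply: subset_trans (setSI _ sC) _.
  apply/subsetP => f /setIP [fX fN]; have := subsetP FN _ (subsetP (fsub _ hX) _ fX).
  by rewrite inE fN.
have [s1 [p1 k1 l1]] := pos _ f1; have [s2 [p2 k2 l2]] := pos _ f2; have [s3 [p3 k3 l3]] := pos _ f3.
pose neg u := odd #|component_edges Z u :&: N|.
have [s4 [p4 k4 l4]] := components_seq Z (fun u => ~~ neg u).
pose W := [set u | is_root Z u && neg u].
(* N lies in Z, so the even number |N| is the sum over the components of Z of their numbers of edges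
   in N. *)
have oW : ~~ odd #|W|.
  move: oN; rewrite -(setIidPr NZ) card_by_component (big_morph odd oddD (erefl _)) /=.
  rewrite -sum1dep_card (big_morph odd oddD (erefl _)) /= big_mkcondr /=.
  by apply: contra; apply: eq_ind; apply: eq_bigr => u _; rewrite -/(neg u); case: (neg u).
have [Q pQ cQ] := short_join oW.
have negC u : u \in W -> exists e, e \in component_edges Z u.
  rewrite inE => /andP [_]; rewrite /neg.
  by case: (set_0Vmem (component_edges Z u)) => [->|[e eC] _]; [rewrite set0I cards0 | exists e].
have [||s5 [p5 k5 l5]] := @barbell_cover _ sigma (component_edges Z) W Q _ _ pQ.
- move=> u uW; have [e eC] := negC _ uW; have cC := component_cycle cubicG evZ eC.
  split; last exact: component_root_vertex eC.
  by split => //; rewrite sg ?cycle_even //; move: uW; rewrite inE => /andP [].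
- move=> u v; rewrite !inE => /andP [ru _] /andP [rv _]; exact: root_vertices_disjoint.
exists (s1 ++ s2 ++ s3 ++ s4 ++ s5).
  split.
    move=> C'; rewrite !mem_cat => /or4P [/p1|/p2|/p3|/orP [|/p5 ?]] //; last by right.
    case/p4 => u [e [nu _ -> eC]]; left; have cC := component_cycle cubicG evZ eC.
    by split => //; rewrite sg ?cycle_even.
  move=> e.
  have lift C' (t : seq {set edge G}) : {subset t <= s1 ++ s2 ++ s3 ++ s4 ++ s5} ->
      C' \in t -> e \in C' -> exists2 C'', C'' \in s1 ++ s2 ++ s3 ++ s4 ++ s5 & e \in C''.
    by move=> sub /sub h eC; exists C'.
  have [eF|eF] := boolP (e \in F).
    have := subsetP cov _ eF; rewrite !in_setU => /or3P [/k1|/k2|/k3] [C' h]; apply: (lift C' _ _ h);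
      by move=> D; rewrite !mem_cat => ->; rewrite ?orbT.
  have eZ : e \in Z.
    have [eN|eN] := boolP (e \in N); first exact: (subsetP NZ).
    exact: bridge_in_even_superset evZ NZ eN eF.
  have [u ru eC] := root_exists eZ.
  have [nu|nu] := boolP (neg u).
    have uW : u \in W by rewrite inE ru.
    have [C' h] := k5 _ _ uW eC; apply: (lift C' _ _ h).
    by move=> D; rewrite !mem_cat => ->; rewrite ?orbT.
  apply: (lift _ s4 _ (k4 _ _ nu ru eC) eC).
  by move=> D; rewrite !mem_cat => ->; rewrite ?orbT.
have lZ : \sum_(u | is_root Z u && ~~ neg u) #|component_edges Z u| +
    \sum_(u in W) #|component_edges Z u| = #|Z|.
  rewrite -[in RHS](setIT Z) card_by_component [RHS](bigID neg) /= addnC; congr (_ + _).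
    by apply: eq_big => [u|u _]; rewrite ?inE ?setIT.
  by apply: eq_bigr => u _; rewrite setIT.
have cZ : #|Z| <= #|N| + #|~: N :\: F| + #|Z :&: F|.
  have h1 := subset_leq_card (subsetIr Z N).
  have h2 : #|(Z :\: N) :&: F| <= #|Z :&: F| by apply: subset_leq_card; apply/setSI/subsetDl.
  have h3 : #|(Z :\: N) :\: F| <= #|~: N :\: F|.
    by apply: subset_leq_card; apply: setSD; rewrite setDE subsetIr.
  by move: (cardsID N Z) (cardsID F (Z :\: N)) h1 h2 h3; clear; lia.
have cE : #|N| + #|~: N :\: F| + #|F| = #|edge G|.
  have := cardsC N; have := cardsID F (~: N); rewrite (setIidPr FN); clear; lia.
(* In the total the coefficient 12/7 - 1/2 of |F| is positive, so |F| = m is the worst case. *)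
have nm := card_edge_vertex.
rewrite /cover_length !big_cat /=; move: l1 l2 l3 l4 l5; rewrite /cover_length.
move: c7 half cQ lZ cZ cE nm; rewrite -/F; clear.
move: (\sum_(_ <- s1) _) (\sum_(_ <- s2) _) (\sum_(_ <- s3) _) (\sum_(_ <- s4) _) (\sum_(_ <- s5) _).
move: (\sum_(_ | _ && _) _) (\sum_(_ in W) _).
move: #|X1| #|X2| #|X3| #|Q| #|Z :&: F| #|Z| #|~: N :\: F| #|N| #|F| #|edge G| #|vertex G|.
by move=> *; lia.
Qed.

End MinimumSignature.

End CubicSignedGraph.

(** Switching at S changes the sign on the edges of X in S, and there is an even number of them. *)
Lemma switch_equiv_even (G : mgraph) (sigma tau : signature G) (X : {set edge G}) :
  0 < #|vertex G| -> switch_equiv sigma tau -> even_set X ->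
  odd #|X :&: negative_edges sigma| = odd #|X :&: negative_edges tau|.
Proof.
move=> V0 /connectP [p]; elim: p sigma => [|rho p IH] sigma /=; first by move=> _ ->.
case/andP => /existsP [S /andP [cS /eqP ->]] pth lst ev; rewrite -(IH _ pth lst ev).
have -> : X :&: negative_edges (switch S sigma) = symd (X :&: S) (X :&: negative_edges sigma).
  by apply/setP => e; rewrite !inE ffunE; case: (e \in X).
have := congr1 odd (card_symd (X :&: S) (X :&: negative_edges sigma)).
by rewrite !oddD oddM andbF addbF (edge_cut_even V0 cS ev) => ->.
Qed.

Local Open Scope ring_scope.

Theorem theorem3p2 (G : mgraph) (sigma : signature G) :
  two_edge_connected G ->
  cubic G ->
  ~~ odd (negativeness sigma) ->
  exists2 n : nat, is_scc sigma n
    & (n%:R < 23%:R / 9%:R * (#|edge G|)%:R :> rat).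
Proof.
move=> connG cubicG; rewrite /negativeness.
case: arg_minnP => [|tau st mn oN]; first exact: connect0.
have V0 := vertex_gt0 connG.
(* Switching at S changes the number of negative edges by |S| - 2|S ∩ N|, which cannot be
   negative. *)
have minN (S : {set edge G}) : edge_cut S -> (#|S :&: negative_edges tau| * 2 <= #|S|)%N.
  move=> cS; have := mn (switch S tau).
  have -> : negative_edges (switch S tau) = symd S (negative_edges tau).
    by apply/setP => e; rewrite !inE ffunE.
  have h : switch_equiv sigma (switch S tau).
    apply: connect_trans st _; apply: connect1; apply/existsP; exists S; by rewrite cS eqxx.
  by move=> /(_ h); have := card_symd S (negative_edges tau); clear; lia.
have [s cs ls] := signed_cover connG cubicG minN oN
  (fun X ev => switch_equiv_even V0 st ev).
have [|n [s' cs' ns'] mns] := @ex_minimum (fun k => exists2 s, circuit_cover sigma s & cover_length s = k).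
  by exists (cover_length s), s.
exists n; first by split; [exists s' | move=> s0 cs0; apply: mns; exists s0].
have nl : (n <= cover_length s)%N by apply: mns; exists s.
have nm := card_edge_vertex cubicG.
(* 107/42 = 321/126 is below 23/9 = 322/126, and the graph has edges because it has a vertex. *)
have lt : (9 * n < 23 * #|edge G|)%N by move: ls nl nm V0; clear; lia.
rewrite mulrAC ltr_pdivlMr ?ltr0n // -!natrM ltr_nat mulnC; exact: lt.
Qed.
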